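(* Let $\mathcal{C}=\{0,\ell e_n,2\ell e_n,\dots,k\ell e_n,w_1,\dots,w_n\}\subset\mathbb{Z}^n$ be a primitive near circuit, with associated data $p,\nu,\lambda_1,\dots,\lambda_\nu,N,\delta$. The number $r$ of real solutions of a generic system with support $\mathcal{C}$ satisfies $$r\ \le\ 2k\overline{\ell}p+k\overline{\ell}\Bigl(\sum_{i=p+1}^\nu\overline{\lambda_i}\Bigr)+\chi(N>0)+1-\chi(\delta>0\text{ is odd})-\chi(\delta=0)-\overline{\ell}\bigl(\chi(\delta=0)+\chi(N=0)\bigr)$$ and $$r\ \le\ 2k\overline{\ell}(\nu-p)+k\overline{\ell}\Bigl(\sum_{i=1}^p\overline{\lambda_i}\Bigr)+\chi(N>0\text{ is even})+1-\chi(\delta<0\text{ is odd})-\chi(\delta=0)-\overline{\ell}\bigl(\chi(\delta=0)+\chi(N=0)\bigr).$$ Moreover, if $\ell$ is even and $N$ is odd, then $$r\ \le\ 2k\nu+1.$$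
   Context: Near circuits: let $k,\ell\ge 1$ be integers, $e_n$ the $n$th standard basis vector, and $w_1,\dots,w_n\in\mathbb{Z}^n$ such that $\{0,\ell e_n,w_1,\dots,w_n\}$ spans $\mathbb{R}^n$ and no $w_i$ lies in $\mathbb{R}e_n$. The set $\mathcal{C}=\{0,\ell e_n,\dots,k\ell e_n,w_1,\dots,w_n\}$ is called a near circuit. It is primitive if the integer linear combinations of its elements give all of $\mathbb{Z}^n$. Associated data: write $w_i=v_i+l_ie_n$ with $0\ne v_i\in\mathbb{Z}^{n-1}$ (the first $n-1$ coordinates), $l_i\in\mathbb{Z}$. If $\mathcal{C}$ is primitive, $v_1,\dots,v_n$ generate $\mathbb{Z}^{n-1}$ and satisfy a linear relation with coprime integer coefficients, unique up to sign. Order the $w_i$ and choose the sign so that this relation is $\sum_{i=1}^p\lambda_iv_i=\sum_{i=p+1}^\nu\lambda_iv_i$ with $0\le p\le\nu\le n$, the $\lambda_i$ positive coprime integers (empty sums are $0$), and $$N:=\sum_{i=p+1}^\nu\lambda_il_i-\sum_{i=1}^p\lambda_il_i\ \ge 0 .$$ Put $\delta:=N+k\ell\sum_{i=1}^p\lambda_i-k\ell\sum_{i=p+1}^\nu\lambda_i$. Notation: for an integer $a$, $\overline{a}=2$ if $a$ is positive and even, $\overline{a}=1$ if $a$ is positive and odd, and $\overline{a}=0$ otherwise. $\chi(Y)\in\{0,1\}$ is the truth value of the statement $Y$; e.g. $\chi(\delta>0\text{ is odd})=1$ iff $\delta$ is positive and odd. A system with support $\mathcal{C}$ is a system of $n$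 real Laurent polynomials in $n$ variables, all of whose exponent vectors lie in $\mathcal{C}$. It is generic if its number of solutions in $(\mathbb{C}^* )^n$ equals the volume of the convex hull of $\mathcal{C}$, normalized so that $[0,1]^n$ has volume $n!$; all solutions are then simple. Real solutions are solutions in $(\mathbb{R}^* )^n$. *)

(* Defs.v *)
From HB Require Import structures.
From mathcomp Require Import all_boot all_order all_algebra finmap.
From mathcomp Require Import all_classical all_reals all_analysis.
From mathcomp Require Import complex.

Set Implicit Arguments.
Unset Strict Implicit.
Unset Printing Implicit Defensive.

Import Order.TTheory GRing.Theory Num.Theory.

Local Open Scope classical_set_scope.
Local Open Scope card_scope.
Local Open Scope ring_scope.

(* The ambient dimension is [n.+1]; vectors are rows, and the last basis vector
   is indexed by [ord_max]. *)

Definition e_last (K : pzRingType) n : 'rV[K]_n.+1 := delta_mx 0 ord_max.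

Section NearCircuit.
Variables (n k l : nat) (w : 'I_n.+1 -> 'rV[int]_n.+1).

Definition near_circuit_points : seq 'rV[int]_n.+1 :=
  [seq (j * l)%N%:Z *: e_last int n | j <- iota 0 k.+1] ++ codom w.

Definition is_near_circuit (R : realType) : Prop :=
  [/\ (1 <= k)%N, (1 <= l)%N,
      span [seq map_mx intr u : 'rV[R]_n.+1
              | u <- [:: 0, l%:Z *: e_last int n & codom w]] = fullv
    & forall i, map_mx intr (w i) \notin <[e_last R n]>%VS].

Definition primitive : Prop :=
  forall u, inIntSpan (in_tuple near_circuit_points) u.

(* [w i = (v_part i, l_part i)]. *)
Definition v_part (i : 'I_n.+1) : 'rV[int]_n := col' ord_max (w i).
Definition l_part (i : 'I_n.+1) : int := w i 0 ord_max.

(* Indices start at 0, so the two sides of the relation run over [i < p] and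
   [p <= i < nu]; the values of [lam] from [nu] on are irrelevant. *)
Variables (p nu : nat) (lam : 'I_n.+1 -> nat).

Definition assoc_N : int :=
  \sum_(i < n.+1 | (p <= i < nu)%N) (lam i)%:Z * l_part i -
  \sum_(i < n.+1 | (i < p)%N) (lam i)%:Z * l_part i.

Definition assoc_delta : int :=
  assoc_N + (k * l)%N%:Z * (\sum_(i < n.+1 | (i < p)%N) (lam i)%:Z)
          - (k * l)%N%:Z * (\sum_(i < n.+1 | (p <= i < nu)%N) (lam i)%:Z).

Definition associated_data : Prop :=
  [/\ (p <= nu <= n.+1)%N,
      forall i : 'I_n.+1, (i < nu)%N -> (0 < lam i)%N,
      \big[gcdn/0]_(i < n.+1 | (i < nu)%N) lam i = 1%N,
      \sum_(i < n.+1 | (i < p)%N) v_part i *+ lam i =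
        \sum_(i < n.+1 | (p <= i < nu)%N) v_part i *+ lam i
    & 0 <= assoc_N].

End NearCircuit.

Definition oddz (a : int) : bool := ~~ (2 %| a)%Z.

Definition overline (a : int) : int :=
  if 0 < a then (if oddz a then 1 else 2) else 0.

Definition chi (b : bool) : int := if b then 1 else 0.

Section Volume.
Variable R : realType.

(* Lebesgue measure on R^n as an iterated product measure. *)
Fixpoint lebesgue_tuple (n : nat) : set (n.-tuple R) -> \bar R :=
  match n with
  | 0 => \d_([tuple] : 0.-tuple R)
  | m.+1 => fun A => ((@lebesgue_measure R) \x (@lebesgue_tuple m))%E
      [set q | A (cons_tuple q.1 q.2)]
  end.

Definition volume (n : nat) (A : set 'rV[R]_n) : \bar R :=
  lebesgue_tuple [set t | A (\row_i tnth t i)].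

Definition convex_hull (n : nat) (A : set 'rV[R]_n) : set 'rV[R]_n :=
  smallest (@convex_set R 'rV[R]_n) A.

(* Normalized so that the unit cube has volume [n`!]. *)
Definition lattice_volume (n : nat) (s : seq 'rV[int]_n) : \bar R :=
  ((n`!)%:R%:E * volume (convex_hull [set map_mx intr u | u in [set` s]]))%E.

End Volume.

(* A Laurent polynomial is its finitely supported family of coefficients,
   indexed by exponent vectors. *)
Definition laurent (K : nmodType) (n : nat) :=
  {fsfun 'rV[int]_n -> K with 0}.

Section Systems.
Variables (R : realType) (n : nat).
Implicit Type f : 'I_n -> laurent R n.

Definition laurent_eval (F : fieldType) (phi : R -> F) (g : laurent R n)
    (x : 'rV[F]_n) : F :=
  \sum_(a <- finsupp g) phi (g a) * \prod_(i < n) x 0 i ^ a 0 i.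

Definition has_support f (C : seq 'rV[int]_n) : Prop :=
  forall j, {subset finsupp (f j) <= C}.

Definition torus_solutions (F : fieldType) (phi : R -> F) f : set 'rV[F]_n :=
  [set x : 'rV[F]_n | (forall i, x 0 i != 0) /\
                      forall j, laurent_eval phi (f j) x = 0].

Definition real_solutions f : set 'rV[R]_n := torus_solutions id f.

Definition complex_solutions f : set 'rV[R[i]]_n :=
  torus_solutions (real_complex R) f.

Definition generic_system f (C : seq 'rV[int]_n) : Prop :=
  exists2 d : nat, complex_solutions f #= `I_d & lattice_volume R C = d%:R%:E.

End Systems.

(* Main.v *)
Require Import Defs.
From mathcomp Require Import all_boot all_order all_algebra finmap.
From mathcomp Require Import all_classical all_reals all_analysis.
From mathcomp Require Import complex polyorder polyrcf.
From mathcomp Require Import zify ring lra.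

Set Implicit Arguments.
Unset Strict Implicit.
Unset Printing Implicit Defensive.

Import Order.TTheory GRing.Theory Num.Theory.
Import numFieldNormedType.Exports.

Local Open Scope classical_set_scope.
Local Open Scope card_scope.
Local Open Scope ring_scope.

(* Put t = x_n, u = t^l and z_i = x^{w_i}.  Primitivity makes x <-> (t, z) a
   bijection of the torus onto the pairs with t^N prod_i z_i^{kappa_i} = 1, where
   kappa is the relation between the v_i with its signs, and the system becomes
   linear in z with coefficients polynomial in u.  If its matrix is invertible,
   z_i = h_i(u) with deg h_i <= k, and the real solutions are those of one
   equation t^N prod_i h_i(t^l)^{kappa_i} = 1.  On the real projective line, two
   consecutive solutions are separated by a critical point of the left-hand side,
   by a zero, or by a pole of even order (or, with the roles exchanged, by a pole
   or a zero of even order); counting critical points by the degree of the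
   logarithmic derivative gives a bound [sum of degree * weight - 2] which is
   subadditive, hence insensitive to degenerations of the h_i, and equals the
   bound of the theorem for l odd.  For l even, N is odd, and t -> -t exchanges the
   equations with right-hand side 1 and -1, so one counts the values u > 0.
   If the matrix is singular, u is restricted to the at most k roots of a
   compatibility polynomial and z to a line over each of them, where the same
   count applies; any larger family would produce infinitely many complex
   solutions, by continuity of roots, against genericity. *)

(** * Rational functions on the real line *)

(** A nonzero polynomial changes sign at a root of odd order, whereas here it is negative at points
    near [c] on both sides. *)
Lemma mu_even_local_max (R : rcfType) (q : {poly R}) (a b c : R) :
  q != 0 -> a < c < b -> (forall x, a < x < b -> q.[x] <= 0) -> 
  ~~ odd (\mu_c q).
Proof.
move=> q0 /andP[ac cb] qle.
have [y yr] := neighpr_wit cb q0; have [x xl] := neighpl_wit ac q0.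
have yab : a < y < b.
  have := next_root_in q c b; move: yr; rewrite /neighpr !in_itv /= max_l ?(ltW cb) //.
  move=> /andP[cy yn] /andP[_ nb].
  by rewrite (lt_trans ac cy) (lt_le_trans yn nb).
have xab : a < x < b.
  have := prev_root_in q a c; move: xl; rewrite /neighpl !in_itv /= min_l ?(ltW ac) //.
  move=> /andP[cy yn] /andP[nb _].
  by rewrite (le_lt_trans nb cy) (lt_trans yn cb).
have ynr : q.[y] < 0.
  rewrite lt_neqAle qle // andbT; exact: (neighpr_root yr).
have xnr : q.[x] < 0.
  rewrite lt_neqAle qle // andbT; exact: (neighpl_root xl).
apply/negP => od; have := sgr_neighpl xl; rewrite od (ltr0_sg xnr) -(sgr_neighpr yr).
rewrite (ltr0_sg ynr); lra.
Qed.

(** The value of [B / A] at [z] exceeds those at both ends, so its maximum on the segment is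
    interior. If [B] vanishes at the maximum, then [B <= 0] on the whole interval and the root has
    even order. *)
Lemma rational_interior_max (R : realType) (A B : {poly R}) (a z b : R) :
  a < z < b -> (forall x, a <= x <= b -> 0 < A.[x]) -> B != 0 ->
  B.[a] * A.[z] < B.[z] * A.[a] -> B.[b] * A.[z] < B.[z] * A.[b] ->
  exists2 c, a < c < b &
    root (A^`() * B - A * B^`()) c && ~~ odd (\mu_c B).
Proof.
move=> /andP[az zb] Apos B0 Ba Bb.
have ab : a <= b by rewrite ltW // (lt_trans az).
pose psi x := B.[x] / A.[x].
have cpsi : {within `[a, b], continuous psi}.
  apply: continuous_in_subspaceT => x; rewrite inE /= in_itv /= => xab.
  apply: continuousM; first exact: continuous_horner.
  apply: continuousV; last exact: continuous_horner.
  by rewrite gt_eqF // Apos.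
have [c cab cmax] := EVT_max ab cpsi.
have lepsi x : a <= x <= b -> B.[x] * A.[c] <= B.[c] * A.[x].
  move=> xab; have := cmax x; rewrite in_itv /= xab => /(_ isT).
  rewrite /psi ler_pdivrMr ?Apos // mulrAC ler_pdivlMr ?Apos //.
have caz : B.[z] * A.[c] <= B.[c] * A.[z] by apply: lepsi; rewrite !ltW.
move: cab; rewrite in_itv /= => cab.
have Az : 0 < A.[z] by apply: Apos; rewrite !ltW.
have Ac : 0 < A.[c] by apply: Apos.
have ca : a < c.
  rewrite lt_neqAle; case/andP: cab => -> _; rewrite andbT.
  by apply/eqP => ac; move: caz; rewrite -ac leNgt Ba.
have cb : c < b.
  rewrite lt_neqAle; case/andP: cab => _ ->; rewrite andbT.
  by apply/eqP => ac; move: caz; rewrite ac leNgt Bb.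
exists c; first by rewrite ca cb.
apply/andP; split.
  (* [F] vanishes at [c] and is nonpositive around it; its derivative at [c] is minus the Wronskian
     there. *)
  pose F := A.[c] *: B - B.[c] *: A.
  have Fc x : a < x < b -> F.[x] <= F.[c].
    move=> /andP[ax xb]; rewrite !hornerE [_ * B.[c]]mulrC subrr subr_le0 mulrC lepsi //.
    by rewrite !ltW.
  have : is_derive c 1 (horner F) 0.
    apply: (derive1_at_max ab) => [t _||t].
    - exact: derivable_horner.
    - by rewrite in_itv /= ca cb.
    - by rewrite in_itv /=; apply: Fc.
  move=> [_ D0]; have [_ D1] := is_derive_poly F c.
  move: D1; rewrite D0 => /esym.
  rewrite rootE /F derivB !derivZ !hornerE => H.
  by apply/eqP; rewrite -[RHS]oppr0 -H; ring.
have [Bc0|Bc0] := eqVneq B.[c] 0; last by rewrite muNroot.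
apply: (@mu_even_local_max _ _ a b) => //; first by rewrite ca cb.
move=> x /andP[ax xb].
have xab : a <= x <= b by rewrite !ltW.
have := lepsi _ xab.
by rewrite Bc0 mul0r pmulr_lle0.
Qed.

Lemma size_sub_lead_lt (R : idomainType) (q t : {poly R}) : q != 0 -> size q = size t ->
  lead_coef q = lead_coef t -> (size (t - q)%R < size q)%N.
Proof.
move=> q0 sqt lqt.
have sA0 : (0 < size q)%N by rewrite size_poly_gt0.
rewrite -(prednK sA0) ltnS; apply/leq_sizeP => j; rewrite leq_eqVlt => /predU1P[<-|jA].
  by rewrite coefB {1}sqt -!/(lead_coef _) lqt subrr.
rewrite prednK // in jA.
by rewrite coefB !nth_default ?subrr // -sqt.
Qed.

(** Squaring removes the absolute values: [e^2 A^2 - F^2] has a positive leading coefficient. *)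
Lemma size_lt_dominated_pinfty (R : rcfType) (F A : {poly R}) (e x : R) :
  (size F < size A)%N -> 0 < e -> exists2 y, x < y & `|F.[y]| < e * `|A.[y]|.
Proof.
move=> sFA e0; have A0 : A != 0 by rewrite -size_poly_gt0 (leq_ltn_trans _ sFA).
pose G := (e ^+ 2) *: A ^+ 2 - F ^+ 2.
have lG : lead_coef G = e ^+ 2 * lead_coef A ^+ 2.
  rewrite /G lead_coefDl ?lead_coefZ ?lead_coef_exp //.
  rewrite size_polyN size_scale ?expf_neq0 ?gt_eqF //.
  rewrite !expr2 (size_mul A0 A0).
  apply: leq_ltn_trans (size_polyMleq _ _) _.
  by move: sFA; move: (size F) (size A) => [|u] [|v] //=; rewrite ?addSn ?addnS /=; lia.
have lG0 : 0 < lead_coef G.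
  by rewrite lG; apply: mulr_gt0; rewrite exprn_even_gt0 //= ?lead_coef_eq0 // gt_eqF.
have [n Hn] := poly_pinfty_gt_lc lG0.
exists (Num.max n (x + 1)); first by rewrite lt_max ltrDl ltr01 orbT.
have /Hn : n <= Num.max n (x + 1) by rewrite le_max lexx.
move: (Num.max _ _) => y /(lt_le_trans lG0).
rewrite /G hornerD hornerN hornerZ !horner_exp subr_gt0 -exprMn => lt2.
rewrite -[e]gtr0_norm // -normrM -ltr_sqr ?nnegrE ?normr_ge0 //.
by rewrite !real_normK ?num_real.
Qed.

Lemma size_lt_dominated_ninfty (R : rcfType) (F A : {poly R}) (e x : R) :
  (size F < size A)%N -> 0 < e -> exists2 y, y < x & `|F.[y]| < e * `|A.[y]|.
Proof.
move=> sFA e0; have sN p : size (p \Po (- 'X : {poly R})) = size p.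
  by rewrite size_comp_poly2 // size_polyN size_polyX.
have sFA' : (size (F \Po (- 'X)) < size (A \Po (- 'X)))%N by rewrite !sN.
have [y xy hy] := size_lt_dominated_pinfty (- x) sFA' e0.
by exists (- y); [rewrite ltrNl | move: hy; rewrite !horner_comp !hornerE].
Qed.

(** * Arcs of the projective line between solutions of [A = B] *)

Section Arcs.
Variables (R : realType) (A B : {poly R}).
Hypotheses (cAB : coprimep A B) (AB : A != B).

(* An arc free of such points carries a monotone branch of [B / A]: poles of
   [B / A] are cut points, and so are its critical points, except its zeros of odd
   order, where it does not turn back. *)
Definition cut_point (z : R) : bool :=
  root A z || root (A^`() * B - A * B^`()) z && ~~ odd (\mu_z B).

Lemma coprime_solution_neq0 x : A.[x] = B.[x] -> A.[x] != 0.
Proof.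
move=> ABx; apply/negP => Ax.
have := coprimep_root cAB Ax; by rewrite -ABx (eqP Ax) eqxx.
Qed.

(** The deviation [|B / A - 1|] is larger at [z] than at both ends, written without quotients so
    that [z] may be a root of [A]. If no root of [A] intervenes, [B / A] or [- B / A] has an
    interior maximum, according to the sign of [B / A - 1] at [z]. *)
Lemma cut_point_between (a z b : R) : B != 0 ->
  a < z < b -> A.[a] != 0 -> A.[b] != 0 ->
  `|B.[a] - A.[a]| * `|A.[z]| < `|B.[z] - A.[z]| * `|A.[a]| ->
  `|B.[b] - A.[b]| * `|A.[z]| < `|B.[z] - A.[z]| * `|A.[b]| ->
  exists2 c, a < c < b & cut_point c.
Proof.
move=> B0 /andP[az zb] Aa Ab ha hb.
have [[c cab rc]|noroot] := EM (exists2 c, a < c < b & root A c).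
  by exists c => //; rewrite /cut_point rc.
have ab : a < b := lt_trans az zb.
have nr x : x \in `[a, b] -> ~~ root A x.
  rewrite in_itv /= => /andP[ax xb]; apply/negP => rx; apply: noroot; exists x => //.
  rewrite !lt_neqAle ax xb !andbT; apply/andP; split; apply/eqP => xe.
    by move: Aa; rewrite xe (eqP rx) eqxx.
  by move: Ab; rewrite -xe (eqP rx) eqxx.
have aab : a \in `[a, b] by rewrite in_itv /= lexx ltW.
pose s : R := Num.sg A.[a].
have s2 : s * s = 1 by rewrite /s -expr2 sqr_sg Aa.
have s0 : s != 0 by rewrite sgr_eq0.
have Apos x : a <= x <= b -> 0 < (s *: A).[x].
  move=> xab; rewrite hornerZ /s.
  have -> : Num.sg A.[a] = Num.sg A.[x].
    by apply: (polyrN0_itv nr); rewrite ?in_itv //= lexx ltW.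
  by rewrite -normrEsg normr_gt0; apply: nr; rewrite in_itv.
have absA x : a <= x <= b -> `|A.[x]| = s * A.[x].
  by move=> xab; rewrite -[RHS]gtr0_norm ?normrM ?normr_sg ?Aa ?mul1r // -hornerZ Apos.
have zab : a <= z <= b by rewrite !ltW.
have [bab aa] : a <= b <= b /\ a <= a <= b by rewrite lexx ltW // lexx.
rewrite !absA // in ha hb.
have key (B' : {poly R}) u : B' = u *: B -> u * u = 1 ->
  B'.[a] * (s * A.[z]) < B'.[z] * (s * A.[a]) ->
  B'.[b] * (s * A.[z]) < B'.[z] * (s * A.[b]) ->
  exists2 c, a < c < b & cut_point c.
  move=> EB u2 ha' hb'.
  have u0 : u != 0 by apply/eqP => u0; move: u2; rewrite u0 mul0r => /esym/eqP; rewrite oner_eq0.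
  have B'0 : B' != 0 by rewrite EB scaler_eq0 negb_or u0.
  have azb : a < z < b by rewrite az.
  have [||c cab] := rational_interior_max azb Apos B'0; rewrite ?hornerZ //.
  move=> /andP[rw]; rewrite EB mu_mulC // => od; exists c => //.
  apply/orP; right; rewrite od andbT; move: rw.
  rewrite EB !derivZ !rootE !(hornerD, hornerN, hornerM, hornerZ) => /eqP rw.
  have : s * u * ((A^`()).[c] * B.[c] - A.[c] * (B^`()).[c]) == 0.
    by apply/eqP; rewrite -rw; ring.
  by rewrite !mulf_eq0 (negPf s0) (negPf u0).
have nrm x : s * (B.[x] - A.[x]) <= `|B.[x] - A.[x]| /\
             - (s * (B.[x] - A.[x])) <= `|B.[x] - A.[x]|.
  have -> : `|B.[x] - A.[x]| = `|s * (B.[x] - A.[x])|.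
    by rewrite normrM normr_sg Aa mul1r.
  by split; [exact: ler_norm | rewrite -normrN; exact: ler_norm].
have nz : `|B.[z] - A.[z]| = `|s * (B.[z] - A.[z])|.
  by rewrite normrM normr_sg Aa mul1r.
have Az : 0 < s * A.[z] by rewrite -hornerZ Apos.
have [/(ler_wpM2r (ltW Az)) na1 /(ler_wpM2r (ltW Az)) na2] := nrm a.
have [/(ler_wpM2r (ltW Az)) nb1 /(ler_wpM2r (ltW Az)) nb2] := nrm b.
rewrite nz in ha hb.
have [sz|sz] := leP 0 (s * (B.[z] - A.[z])).
- rewrite (ger0_norm sz) in ha hb.
  apply: (key (s *: B) s) => //; rewrite !hornerZ; lra.
- rewrite (ltr0_norm sz) in ha hb.
  by apply: (key (- s *: B) (- s)) => //; first (by rewrite mulrNN); rewrite !hornerZ; lra.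
Qed.

Hypotheses (sAB : size A = size B) (lAB : lead_coef A = lead_coef B).

Let A0 : A != 0.
Proof.
apply/eqP => A0; move: AB sAB; rewrite A0 size_poly0 eq_sym => B0 /esym/eqP.
by rewrite size_poly_eq0 (negPf B0).
Qed.

Let B0 : B != 0.
Proof. by rewrite -size_poly_gt0 -sAB size_poly_gt0. Qed.

Let BA0 : B - A != 0.
Proof. by rewrite subr_eq0 eq_sym. Qed.

Let sBA : (size (B - A)%R < size A)%N.
Proof. exact: size_sub_lead_lt. Qed.

Let noroot_between (a b : R) : a < b -> exists2 z, a < z < b & (B - A).[z] != 0.
Proof.
move=> ab; have [y yr] := neighpr_wit ab BA0.
exists y; last by have := neighpr_root yr.
have := next_root_in (B - A) a b; move: yr; rewrite /neighpr !in_itv /= max_l ?(ltW ab) //.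
by move=> /andP[-> yn] /andP[_ nb]; rewrite (lt_le_trans yn nb).
Qed.

Let end_solution (z x : R) : (B - A).[z] != 0 -> A.[x] = B.[x] ->
  A.[x] != 0 /\ `|B.[x] - A.[x]| * `|A.[z]| < `|B.[z] - A.[z]| * `|A.[x]|.
Proof.
rewrite hornerD hornerN => Fz /[dup] /coprime_solution_neq0 Ax ABx; split => //.
by rewrite -ABx subrr normr0 mul0r mulr_gt0 ?normr_gt0.
Qed.

(** Since [A] and [B] have the same leading term, [B / A] tends to 1 at infinity, so a point far
    enough out can replace a solution as the end of an arc. The [+ 1] covers the case [A.[z] =
    0]. *)
Let end_infinite (z x : R) : (B - A).[z] != 0 ->
    `|(B - A).[x]| < `|(B - A).[z]| / (`|A.[z]| + 1) * `|A.[x]| ->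
  A.[x] != 0 /\ `|B.[x] - A.[x]| * `|A.[z]| < `|B.[z] - A.[z]| * `|A.[x]|.
Proof.
rewrite !hornerD !hornerN => Fz lt.
have z1 : 0 < `|A.[z]| + 1 by rewrite ltr_wpDl.
split.
  by apply/eqP => Ax; move: lt; rewrite Ax normr0 mulr0 normr_lt0.
move: lt; rewrite mulrAC ltr_pdivlMr //; apply: le_lt_trans.
by rewrite ler_wpM2l // lerDl.
Qed.

Let eps_gt0 z : (B - A).[z] != 0 -> 0 < `|(B - A).[z]| / (`|A.[z]| + 1).
Proof. by move=> Fz; rewrite divr_gt0 ?normr_gt0 // ltr_wpDl. Qed.

Lemma cut_point_bounded_arc a b : a < b -> A.[a] = B.[a] -> A.[b] = B.[b] ->
  exists2 c, a < c < b & cut_point c.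
Proof.
move=> ab sa sb; have [z zab Fz] := noroot_between ab.
have [Aa ha] := end_solution Fz sa; have [Ab hb] := end_solution Fz sb.
exact: (cut_point_between B0 zab).
Qed.

Lemma cut_point_right_arc a : A.[a] = B.[a] -> exists2 c, a < c & cut_point c.
Proof.
move=> sa; have aa : a < a + 1 by rewrite ltrDl.
have [z /andP[az _] Fz] := noroot_between aa.
have [y zy /(end_infinite Fz) [Ay hy]] := size_lt_dominated_pinfty z sBA (eps_gt0 Fz).
have [Aa ha] := end_solution Fz sa.
have azy : a < z < y by rewrite az.
by have [c /andP[ac _] cc] := cut_point_between B0 azy Aa Ay ha hy; exists c.
Qed.

Lemma cut_point_left_arc b : A.[b] = B.[b] -> exists2 c, c < b & cut_point c.
Proof.
move=> sb; have bb : b - 1 < b by rewrite ltrBlDr ltrDl.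
have [z /andP[_ zb] Fz] := noroot_between bb.
have [x xz /(end_infinite Fz) [Ax hx]] := size_lt_dominated_ninfty z sBA (eps_gt0 Fz).
have [Ab hb] := end_solution Fz sb.
have xzb : x < z < b by rewrite xz.
by have [c /andP[_ cb] cc] := cut_point_between B0 xzb Ax Ab hx hb; exists c.
Qed.

(** For an empty list of solutions, the only arc leaves infinity and returns to it. *)
Lemma cut_point_line : exists c, cut_point c.
Proof.
have [z _ Fz] := noroot_between (@ltr01 R).
have [x xz /(end_infinite Fz) [Ax hx]] := size_lt_dominated_ninfty z sBA (eps_gt0 Fz).
have [y zy /(end_infinite Fz) [Ay hy]] := size_lt_dominated_pinfty z sBA (eps_gt0 Fz).
have xzy : x < z < y by rewrite xz.
by have [c _ cc] := cut_point_between B0 xzy Ax Ay hx hy; exists c.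
Qed.

(** Each solution contributes the arc on its right, the last one being unbounded; the order along
    the path makes the cut points distinct. *)
Lemma cut_points_right a s : path <%R a s ->
    A.[a] = B.[a] -> {in s, forall x, A.[x] = B.[x]} ->
  exists2 Y : seq R, size Y = (size s).+1 & path <%R a Y /\ all cut_point Y.
Proof.
elim: s a => [|b s IH] a /= => [_ sa _|/andP[ab sb] sa ss].
  by have [c ac cc] := cut_point_right_arc sa; exists [:: c] => //=; rewrite ac cc.
have Ab : A.[b] = B.[b] by apply: ss; rewrite mem_head.
have [|Y sY [pY aY]] := IH _ sb Ab.
  by move=> x xs; apply: ss; rewrite inE xs orbT.
have [c /andP[ac cb] cc] := cut_point_bounded_arc ab sa Ab.
exists (c :: Y); first by rewrite /= sY.
rewrite /= ac cc aY; split => //=.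
by case: Y pY {sY aY} => //= y Y /andP[/(lt_trans cb) -> ->].
Qed.

(** Equal degrees and leading coefficients make infinity a further solution, so the projective line
    is cut into [size s + 1] arcs, each with a cut point in its interior. *)
Lemma cut_points_exist (s : seq R) : uniq s -> {in s, forall x, A.[x] = B.[x]} ->
  exists2 Y : seq R, size Y = (size s).+1 & uniq Y /\ all cut_point Y.
Proof.
rewrite -(sort_uniq <=%R) -(size_sort <=%R) => us ss.
have {ss} : {in sort <=%R s, forall x, A.[x] = B.[x]}.
  by move=> x; rewrite mem_sort; apply: ss.
have {us} : sorted <%R (sort <=%R s) by rewrite lt_sorted_uniq_le us sort_le_sorted.
case: (sort _ _) => [_ _|b {}s /= pb sb].
  by have [c cc] := cut_point_line; exists [:: c] => //=; rewrite cc.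
have Ab : A.[b] = B.[b] by apply: sb; rewrite mem_head.
have [|Y sY [pY aY]] := cut_points_right pb Ab.
  by move=> x xs; apply: sb; rewrite inE xs orbT.
have [c cb cc] := cut_point_left_arc Ab.
exists (c :: Y); first by rewrite /= sY.
split; last by rewrite /= cc.
apply: (@lt_sorted_uniq _ _ (c :: Y)) => /=.
by case: Y pY {sY aY} => //= y Y /andP[/(lt_trans cb) -> ->].
Qed.
End Arcs.

(** * Counting the solutions of a product equation *)

(* Contribution of a point of order [e] to the bound, for [e <> 0]: 1 because it
   costs the critical point count one less than its multiplicity, plus 1 if it
   separates solutions, i.e. unless it is a pole of odd order. *)
Definition weight (e : int) : nat :=
  if e == 0 then 0 else if (e < 0) && odd `|e|%N then 1 else 2.

Lemma weight0 : weight 0 = 0%N. Proof. by []. Qed.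

(** When both arguments are nonzero, each weighs at least 1, while no weight exceeds 2. *)
Lemma weightD a b : (weight (a + b)%R <= weight a + weight b)%N.
Proof.
rewrite /weight; case: (eqVneq a 0) => [->|a0]; first by rewrite add0r.
case: (eqVneq b 0) => [->|b0]; first by rewrite addr0 addn0 (negPf a0).
case: eqP => // _.
by case: ifP => // h; case: ifP => ha; case: ifP => hb //=; lia.
Qed.

Lemma weight_sum (I : Type) (r : seq I) (P : pred I) (F : I -> int) :
  (weight (\sum_(i <- r | P i) F i)%R <= \sum_(i <- r | P i) weight (F i))%N.
Proof.
by elim/big_ind2: _ => // x m y k hx hy; apply: leq_trans (weightD _ _) _; apply: leq_add.
Qed.

Lemma weight_mulnz (m : nat) (e : int) : (weight (m%:Z * e)%R <= m * weight e)%N.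
Proof.
elim: m => [|m IH]; first by rewrite mul0r.
rewrite -addn1 PoszD mulrDl mul1r addn1 mulSn addnC.
by apply: leq_trans (weightD _ _) _; rewrite leq_add2r.
Qed.

Lemma weight_gt0 e : (0 < weight e)%N = (e != 0).
Proof. by rewrite /weight; case: eqP => //= _; case: ifP. Qed.

(** * Multiplicities, degrees and Wronskians of products of powers *)

Section PolyTools.
Variable R : rcfType.
Implicit Types (q t : {poly R}).

Lemma sum_mu_le_size (Y : seq R) q : uniq Y -> q != 0 ->
  (\sum_(z <- Y) \mu_z q <= (size q).-1)%N.
Proof.
elim: Y q => [|z Y IH] q /=; first by rewrite big_nil.
move=> /andP[zY uY] q0; rewrite big_cons.
have [q1 q1z qE] := mu_spec z q0.
have q10 : q1 != 0 by apply: contraNneq q1z => ->; rewrite root0.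
have Xn0 : ('X - z%:P) ^+ \mu_z q != 0 by rewrite expf_neq0 // polyXsubC_eq0.
have -> : (\sum_(y <- Y) \mu_y q = \sum_(y <- Y) \mu_y q1)%N.
  rewrite !big_seq; apply: eq_bigr => y yY; rewrite {1}qE mu_mul -?qE //.
  rewrite [X in (_ + X)%N]muNroot ?addn0 // rootE horner_exp hornerXsubC expf_neq0 //.
  by rewrite subr_eq0; apply: contraNneq zY => <-.
have sq : size q = (size q1 + \mu_z q)%N.
  by rewrite {1}qE size_mul // size_exp_XsubC addnS.
have : (0 < size q1)%N by rewrite size_poly_gt0.
have := IH _ uY q10.
by rewrite sq; case: (size q1) => // s1 h _; move: h; rewrite addSn /= addnC leq_add2r.
Qed.

Variables (I : finType) (p : I -> {poly R}).
Hypothesis p0 : forall i, p i != 0.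

Lemma mu_prod_exp (P : pred I) (m : I -> nat) z :
  \mu_z (\prod_(i | P i) p i ^+ m i) = (\sum_(i | P i) \mu_z (p i) * m i)%N.
Proof.
suff [] : (\prod_(i | P i) p i ^+ m i != 0) /\
  \mu_z (\prod_(i | P i) p i ^+ m i) = (\sum_(i | P i) \mu_z (p i) * m i)%N by [].
elim/big_ind2: _ => [|q a t b [q0 <-] [t0 <-]|i _].
- by rewrite oner_neq0 -[1]/(1%:P) mu_polyC.
- by rewrite mulf_neq0 // mu_mul // mulf_neq0.
- by rewrite expf_neq0 // mu_exp.
Qed.

Lemma size_prod_exp (P : pred I) (m d : I -> nat) :
  (forall i, size (p i) = (d i).+1) ->
  size (\prod_(i | P i) p i ^+ m i) = (\sum_(i | P i) d i * m i).+1%N.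
Proof.
move=> sp; suff [] : (\prod_(i | P i) p i ^+ m i != 0) /\
  size (\prod_(i | P i) p i ^+ m i) = (\sum_(i | P i) d i * m i).+1%N by [].
elim/big_ind2: _ => [|q a t b [q0 sq] [t0 st]|i _].
- by rewrite oner_neq0 size_poly1.
- by rewrite mulf_neq0 // size_mul // sq st addSn /= addnS.
- split; first by rewrite expf_neq0.
  by rewrite my_size_exp ?p0 // sp.
Qed.

(** By the Leibniz rule, differentiation lowers the exponent of each factor by at most one. *)
Lemma dvdp_prod_deriv (P : pred I) (m : I -> nat) :
  let t := \prod_(i | P i) p i ^+ (m i).-1 in
  let q := \prod_(i | P i) p i ^+ m i in
  (t %| q) && (t %| q^`()).
Proof.
rewrite /=; elim/big_ind2: _ => [|q a t b /andP[h1 h2] /andP[h3 h4]|i _].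
- by rewrite !dvd1p.
- by rewrite dvdp_mul // derivM dvdp_add // dvdp_mul.
- rewrite dvdp_exp2l ?leq_pred // deriv_exp -mulrnAl.
  by rewrite dvdp_mulIr.
Qed.
End PolyTools.

(** Moving the negative powers to the other side replaces a rational equation by a polynomial
    one. *)
Lemma prod_exprz_eq1 (F : fieldType) (I : finType) (v : I -> F) (e : I -> int) :
  (forall i, v i != 0) ->
  (\prod_i v i ^ e i == 1) =
  (\prod_(i | 0 < e i) v i ^+ `|e i| == \prod_(i | e i < 0) v i ^+ `|e i|).
Proof.
move=> v0; have h : \prod_i v i ^ e i =
  \prod_(i | 0 < e i) v i ^+ `|e i| / \prod_(i | e i < 0) v i ^+ `|e i|.
  rewrite (bigID (fun i => 0 < e i)) /=; congr (_ * _).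
    by apply: eq_bigr => i ei; rewrite -{1}(gtz0_abs ei).
  rewrite -prodfV (bigID (fun i => e i < 0)) /= [X in _ * X]big1 ?mulr1.
    apply: congr_big => // i; first by case: ltgtP.
    by move=> /andP[_ ei]; rewrite -[in LHS](opprK (e i)) -(ltz0_abs ei) exprnN.
  move=> i; rewrite -!leNgt -eq_le => /eqP ->; exact: expr0z.
rewrite h -subr_eq0 -(inj_eq (mulIf (_ : \prod_(i | e i < 0) v i ^+ `|e i| != 0))).
  by rewrite mul0r mulrBl mul1r divfK ?subr_eq0 //; apply/prodf_neq0 => i _; rewrite expf_neq0.
by apply/prodf_neq0 => i _; rewrite expf_neq0.
Qed.

(** Both products have degree [2D - 1] and the same leading coefficient, which cancels. *)
Lemma size_wronskian_lt (R : rcfType) (A B : {poly R}) D :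
  size A = D.+1 -> size B = D.+1 -> lead_coef A = lead_coef B ->
  A^`() * B - A * B^`() != 0 -> (size (A^`() * B - A * B^`())%R < D.*2)%N.
Proof.
move=> sA sB lAB W0.
case: D sA sB => [|D] sA sB.
  have d0 (q : {poly R}) : size q = 1%N -> q^`() = 0.
    by move=> sq; apply/eqP; rewrite -size_poly_eq0 size_deriv sq.
  by move: W0; rewrite !d0 // mul0r mulr0 subrr eqxx.
have q0 (q : {poly R}) m : size q = m.+1 -> q != 0.
  by move=> sq; rewrite -size_poly_gt0 sq.
have sd (q : {poly R}) : size q = D.+2 -> size (q^`()) = D.+1.
  by move=> sq; rewrite size_deriv sq.
have ld (q : {poly R}) : size q = D.+2 -> lead_coef q^`() = lead_coef q *+ D.+1.
  by move=> sq; rewrite lead_coefE sd // coef_deriv lead_coefE sq.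
have A0 := q0 _ _ sA; have B0 := q0 _ _ sB.
have dA0 := q0 _ _ (sd _ sA); have dB0 := q0 _ _ (sd _ sB).
have sAB' : size (A * B^`()) = D.+1.*2 by rewrite size_mul // sA sd // addSn -addnn addnS.
have sA'B : size (A^`() * B) = D.+1.*2 by rewrite size_mul // sB sd // -addnn addnS.
rewrite -sA'B -opprB size_polyN; apply: size_sub_lead_lt; rewrite ?mulf_neq0 // ?sAB' ?sA'B //.
by rewrite !lead_coefM !ld // lAB mulrnAl mulrnAr.
Qed.

(** Each term of the Wronskian has [A] or its derivative as a factor, whose order at [z] is at least
    that of [A] minus one; likewise for [B]. *)
Lemma mu_wronskian_ge (R : rcfType) (A B : {poly R}) z :
  A^`() * B - A * B^`() != 0 ->
  ((\mu_z A).-1 <= \mu_z (A^`() * B - A * B^`())%R)%N /\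
  ((\mu_z B).-1 <= \mu_z (A^`() * B - A * B^`())%R)%N.
Proof.
move=> W0.
have h (q : {poly R}) :
    (('X - z%:P) ^+ (\mu_z q).-1 %| q) && (('X - z%:P) ^+ (\mu_z q).-1 %| q^`()).
  have [->|q0] := eqVneq q 0; first by rewrite deriv0 !dvdp0.
  have [q1 _ qE] := mu_spec z q0.
  have dvd1 : ('X - z%:P) ^+ (\mu_z q).-1 %| ('X - z%:P) ^+ \mu_z q.
    by rewrite dvdp_exp2l // leq_pred.
  have dvd2 : ('X - z%:P) ^+ (\mu_z q).-1 %| (('X - z%:P) ^+ \mu_z q)^`().
    by rewrite deriv_exp -mulrnAl dvdp_mulIr.
  rewrite {2 4}qE derivM dvdp_mull //=.
  by rewrite dvdp_add // dvdp_mull.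
have /andP[A1 A2] := h A; have /andP[B1 B2] := h B.
by rewrite -!root_le_mu //; split; apply: dvdp_sub;
  by [apply: dvdp_mulr | apply: dvdp_mull].
Qed.

Lemma signed_sum (I : finType) (m : I -> nat) (e : I -> int) :
  \sum_i (m i)%:Z * e i =
  (\sum_(i | (0 < e i)%R) m i * `|e i|)%N%:Z - (\sum_(i | (e i < 0)%R) m i * `|e i|)%N%:Z.
Proof.
rewrite -!natz !natr_sum [LHS](bigID (fun i => 0 < e i)) /=; congr (_ + _).
  by apply: eq_bigr => i ei; rewrite natz PoszM gtz0_abs.
rewrite (bigID (fun i => e i < 0)) /= [X in _ + X]big1 ?addr0; last first.
  by move=> i; rewrite -!leNgt -eq_le => /eqP ->; rewrite mulr0.
rewrite -sumrN; apply: congr_big => // i; first by case: ltgtP.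
by move=> /andP[_ ei]; rewrite natz PoszM ltz0_abs // mulrN opprK.
Qed.

(** * The Rolle-type bound when infinity is a solution *)

Section AffineRolle.
Variables (R : realType) (I : finType) (p : I -> {poly R}).
Variables (d : I -> nat) (e : I -> int).
Hypotheses (sp : forall i, size (p i) = (d i).+1)
  (e0 : forall i, e i = 0 -> d i = 0%N)
  (de : \sum_i (d i)%:Z * e i = 0)
  (lp : \prod_i lead_coef (p i) ^ e i = 1).

Let p0 i : p i != 0. Proof. by rewrite -size_poly_gt0 sp. Qed.

(** The hypotheses on degrees and leading coefficients make infinity a solution, so there are
    [size s + 1] cut points. Each satisfies a local inequality relating 1, the orders of the [p i]
    and the order of [Q], the part of the Wronskian not forced by the powers. The sum over the cut
    points is compared with the degree of [Q]. *)
Lemma affine_rolle (s : seq R) (y : R) : uniq s ->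
  {in s, forall x, (forall i, (p i).[x] != 0) /\ \prod_i (p i).[x] ^ e i = 1} ->
  (forall i, (p i).[y] != 0) -> \prod_i (p i).[y] ^ e i != 1 ->
  (size s + 3 <= \sum_i d i * weight (e i))%N.
Proof.
move=> us ss y0 y1.
pose A := \prod_(i | 0 < e i) p i ^+ `|e i|; pose B := \prod_(i | e i < 0) p i ^+ `|e i|.
have sA : size A = (\sum_(i | (0 < e i)%R) d i * `|e i|).+1%N by apply: size_prod_exp.
have sB : size B = (\sum_(i | (e i < 0)%R) d i * `|e i|).+1%N by apply: size_prod_exp.
have e_abs i : (d i * (`|e i|%N).-1 + d i = d i * `|e i|)%N.
  case: (eqVneq (e i) 0) => [/e0 -> //|]; rewrite -absz_gt0.
  by case: `|e i|%N => // m _; rewrite mulnSr.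
have sumabs : (\sum_i d i * `|e i| =
    \sum_(i | (0 < e i)%R) d i * `|e i| + \sum_(i | (e i < 0)%R) d i * `|e i|)%N.
  rewrite (bigID (fun i => 0 < e i)) /=; congr (_ + _)%N.
  rewrite (bigID (fun i => e i < 0)) /= [X in (_ + X)%N]big1 ?addn0.
    by apply: eq_bigl => i; case: ltgtP.
  by move=> i; rewrite -!leNgt -eq_le => /eqP ->; rewrite muln0.
have sAsB : (\sum_(i | (0 < e i)%R) d i * `|e i| = \sum_(i | (e i < 0)%R) d i * `|e i|)%N.
  by apply/eqP; rewrite -eqz_nat -subr_eq0 -signed_sum de.
have A0 : A != 0 by rewrite -size_poly_gt0 sA.
have B0 : B != 0 by rewrite -size_poly_gt0 sB.
have lAB : lead_coef A = lead_coef B.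
  have lp0 i : lead_coef (p i) != 0 by rewrite lead_coef_eq0.
  have /eqP := lp; rewrite prod_exprz_eq1 // => /eqP.
  by rewrite !lead_coef_prod => h; under eq_bigr do rewrite lead_coef_exp;
    under [in RHS]eq_bigr do rewrite lead_coef_exp.
have evA x : A.[x] = \prod_(i | 0 < e i) (p i).[x] ^+ `|e i|.
  by rewrite horner_prod; apply: eq_bigr => i _; rewrite horner_exp.
have evB x : B.[x] = \prod_(i | e i < 0) (p i).[x] ^+ `|e i|.
  by rewrite horner_prod; apply: eq_bigr => i _; rewrite horner_exp.
have ABs x : (forall i, (p i).[x] != 0) -> (\prod_i (p i).[x] ^ e i == 1) = (A.[x] == B.[x]).
  by move=> px; rewrite prod_exprz_eq1 // evA evB.
(* The [p i] may have common roots, so numerator and denominator are first made coprime; at a common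
   root the exponents add up. *)
pose C := gcdp A B; pose A1 := A %/ C; pose B1 := B %/ C.
have C0 : C != 0 by rewrite gcdp_eq0 negb_and A0.
have AE : A = A1 * C by rewrite divpK // dvdp_gcdl.
have BE : B = B1 * C by rewrite divpK // dvdp_gcdr.
have A10 : A1 != 0 by apply: contraNneq A0 => h; rewrite AE h mul0r.
have B10 : B1 != 0 by apply: contraNneq B0 => h; rewrite BE h mul0r.
have cAB : coprimep A1 B1 by rewrite coprimep_div_gcd // A0.
have AB1 : A1 != B1.
  by apply: contraNneq y1 => h; rewrite ABs // AE BE h.
have sAB1 : size A1 = size B1.
  have : size (A1 * C) = size (B1 * C) by rewrite -AE -BE sA sB sAsB.
  rewrite !size_mul //; have : (0 < size C)%N by rewrite size_poly_gt0.
  by case: (size C) => // c _; rewrite !addnS /= => /addIn.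
have lAB1 : lead_coef A1 = lead_coef B1.
  have C1 : lead_coef C != 0 by rewrite lead_coef_eq0.
  by apply: (mulIf C1); rewrite -!lead_coefM -AE -BE.
have sols : {in s, forall x, A1.[x] = B1.[x]}.
  move=> x /ss [px /eqP]; rewrite ABs // => /eqP ABx.
  have Ax : A.[x] != 0 by rewrite evA; apply/prodf_neq0 => i _; rewrite expf_neq0.
  have Cx : C.[x] != 0 by apply: contraNneq Ax => h; rewrite AE hornerM h mulr0.
  by apply: (mulIf Cx); rewrite -!hornerM -AE -BE.
have [Y sY [uY /allP cY]] := cut_points_exist cAB AB1 sAB1 lAB1 us sols.
pose W1 := A1^`() * B1 - A1 * B1^`().
pose W := A^`() * B - A * B^`().
have WE : W = W1 * C ^+ 2.
  by rewrite /W AE BE !derivM /W1; ring.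
(* If the Wronskian vanished, [A1] would divide its own derivative by coprimality; [A1] and [B1]
   would then be constants with the same leading coefficient, hence equal. *)
have W10 : W1 != 0.
  apply/eqP => /eqP; rewrite subr_eq0 => /eqP We.
  have : A1 %| A1^`() * B1 by rewrite We dvdp_mulIl.
  rewrite Gauss_dvdpl // => dA.
  have /eqP dA0 : A1^`() == 0.
    apply: contraTT dA => dA0; apply/negP => /(dvdp_leq dA0).
    rewrite size_deriv; have : (0 < size A1)%N by rewrite size_poly_gt0.
    by case: (size A1) => // m _; rewrite ltnn.
  have s1 : (size A1 <= 1)%N.
    by move/eqP: dA0; rewrite -size_poly_eq0 size_deriv; case: (size A1) => [|[]].
  have s2 : (size B1 <= 1)%N by rewrite -sAB1.
  case/eqP: AB1; rewrite (size1_polyC s1) (size1_polyC s2).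
  by move: lAB1; rewrite (size1_polyC s1) (size1_polyC s2) !lead_coefC => ->.
have W0 : W != 0 by rewrite WE mulf_neq0 // expf_neq0.
(* [T] divides the Wronskian because of the exponents alone; the quotient [Q] carries the remaining
   critical points. *)
pose T := \prod_i p i ^+ (`|e i|.-1).
have T0 : T != 0 by apply/prodf_neq0 => i _; rewrite expf_neq0.
have /dvdpP[Q QE] : T %| W.
  have -> : T = (\prod_(i | 0 < e i) p i ^+ (`|e i|.-1)) * (\prod_(i | e i < 0) p i ^+ (`|e i|.-1)).
    rewrite /T (bigID (fun i => 0 < e i)) /=; congr (_ * _).
    rewrite (bigID (fun i => e i < 0)) /= [X in (_ * X)]big1 ?mulr1.
      by apply: eq_bigl => i; case: ltgtP.
    by move=> i; rewrite -!leNgt -eq_le => /eqP ->.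
  have /andP[A_ A_'] := dvdp_prod_deriv p (fun i => 0 < e i) (fun i => `|e i|%N).
  have /andP[B_ B_'] := dvdp_prod_deriv p (fun i => e i < 0) (fun i => `|e i|%N).
  by rewrite dvdp_sub // dvdp_mul.
have Q0 : Q != 0 by apply: contraNneq W0 => h; rewrite QE h mul0r.
have sT : size T = (\sum_i d i * (`|e i|.-1)).+1%N by apply: size_prod_exp.
(* With [2D] the sum of the [d i * |e i|], the Wronskian has degree at most [2D - 2], and [T] has
   degree [2D] minus the sum of the [d i]. *)
have sQ : ((size Q).-1 + 2 <= \sum_i d i)%N.
  have := size_wronskian_lt sA (etrans sB (congr1 succn (esym sAsB))) lAB W0.
  rewrite -/W QE size_mul // sT -addnn {2}sAsB -sumabs.
  have <- : (\sum_i d i * `|e i|.-1 + \sum_i d i = \sum_i d i * `|e i|)%N.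
    by rewrite -big_split /=; apply: eq_bigr => i _; rewrite e_abs.
  have : (0 < size Q)%N by rewrite size_poly_gt0.
  move: (size Q) (\sum_i d i * _)%N (\sum_i d i)%N => [|q] // a b _.
  clear; lia.
(* The net order at [z] is that of [A1] minus that of [B1], and its weight is at most the last sum
   by subadditivity. At a root of [A1] of order [a] the net weight is 2 and the Wronskian [W1] has
   order at least [a - 1]. At any other cut point [W1] vanishes, and a root of [B1] there has even
   order, hence weight 2. *)
have loc z : z \in Y -> (1 + \sum_i \mu_z (p i) <=
    \mu_z Q + \sum_i \mu_z (p i) * weight (e i))%N.
  move=> /cY; rewrite /cut_point -/W1 => cz.
  have muA : \mu_z A = (\mu_z A1 + \mu_z C)%N by rewrite {1}AE mu_mul // -AE.
  have muB : \mu_z B = (\mu_z B1 + \mu_z C)%N by rewrite {1}BE mu_mul // -BE.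
  have muAs : \mu_z A = (\sum_(i | (0 < e i)%R) \mu_z (p i) * `|e i|)%N by apply: mu_prod_exp.
  have muBs : \mu_z B = (\sum_(i | (e i < 0)%R) \mu_z (p i) * `|e i|)%N by apply: mu_prod_exp.
  have muT : \mu_z T = (\sum_i \mu_z (p i) * (`|e i|.-1))%N by apply: mu_prod_exp.
  have mue0 i : e i = 0 -> \mu_z (p i) = 0%N.
    by move=> /e0 di; rewrite (size1_polyC (_ : size (p i) <= 1)%N) ?mu_polyC // sp di.
  have muW : (\mu_z Q + \mu_z T = \mu_z W1 + \mu_z C * 2)%N.
    by rewrite -mu_exp -!mu_mul -?WE -?QE.
  have muQ : (\mu_z Q + \mu_z A1 + \mu_z B1 = \mu_z W1 + \sum_i \mu_z (p i))%N.
    have : (\mu_z T + \sum_i \mu_z (p i) = \mu_z A + \mu_z B)%N.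
      rewrite muT muAs muBs -big_split /= [LHS](bigID (fun i => 0 < e i)) /=; congr (_ + _)%N.
        by apply: eq_bigr => i ei; rewrite -[X in (_ + X)%N]muln1 -mulnDr addn1 prednK // absz_gt0 gt_eqF.
      rewrite (bigID (fun i => e i < 0)) /= [X in (_ + X)%N]big1 ?addn0.
        apply: congr_big => // i; first by case: ltgtP.
        move=> /andP[_ ei]; rewrite -[X in (_ + X)%N]muln1 -mulnDr addn1 prednK // absz_gt0.
        by rewrite lt_eqF.
      by move=> i; rewrite -!leNgt -eq_le => /eqP /esym ei; rewrite mue0.
    move: muW; rewrite muA muB.
    move: (\mu_z Q) (\mu_z T) (\mu_z W1) (\mu_z C) (\mu_z A1) (\mu_z B1) (\sum_i _)%N.
    clear; lia.
  have esum : \sum_i (\mu_z (p i))%:Z * e i = (\mu_z A1)%:Z - (\mu_z B1)%:Z.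
    rewrite signed_sum -muAs -muBs muA muB !PoszD; ring.
  have : (weight ((\mu_z A1)%:Z - (\mu_z B1)%:Z)%R <= \sum_i \mu_z (p i) * weight (e i))%N.
    rewrite -esum; apply: leq_trans (weight_sum _ _ _) _; apply: leq_sum => i _.
    exact: weight_mulnz.
  have [mA1 mB1] := mu_wronskian_ge z W10.
  have coA : (0 < \mu_z A1)%N -> \mu_z B1 = 0%N.
    by rewrite mu_gt0 // => rA; apply: muNroot; apply: (coprimep_root cAB rA).
  have : (0 < \mu_z A1)%N \/ (0 < \mu_z W1)%N /\ ~~ odd (\mu_z B1).
    by case/orP: cz => [rA|/andP[rW ->]]; [left; rewrite mu_gt0 | right; rewrite mu_gt0].
  move: muQ mA1 mB1 coA; rewrite -/W1.
  move: (\mu_z Q) (\mu_z W1) (\mu_z A1) (\mu_z B1) (\sum_i _ * _)%N (\sum_i _)%N.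
  clear; move=> q w a b S M; rewrite /weight => h1 h2 h3 h4 h5 h6.
  case: ifP h6 => h7; first lia.
  case: ifP => h8; lia.
have := sum_mu_le_size uY Q0.
have : (\sum_(z <- Y) (1 + \sum_i \mu_z (p i)) <=
    \sum_(z <- Y) (\mu_z Q + \sum_i \mu_z (p i) * weight (e i)))%N.
  by rewrite !big_seq; apply: leq_sum => z /loc.
have : (\sum_i \sum_(z <- Y) \mu_z (p i) * weight (e i) + \sum_i d i <=
   \sum_i d i * weight (e i) + \sum_i \sum_(z <- Y) \mu_z (p i))%N.
  rewrite -!big_split /=; apply: leq_sum => i _.
  rewrite -big_distrl /=.
  have := sum_mu_le_size uY (p0 i); rewrite sp /=.
  move: (\sum_(_ <- _) _)%N => m md.
  have [/e0 di|] := eqVneq (e i) 0.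
    by move: md; rewrite di leqn0 => /eqP ->; rewrite !mul0n.
  by rewrite -weight_gt0; move: md; clear; nia.
have ex (F : R -> I -> nat) : (\sum_(z <- Y) \sum_i F z i = \sum_i \sum_(z <- Y) F z i)%N.
  exact: exchange_big.
rewrite !big_split /= sum1_size sY !ex.
move: sQ; set M := (\sum_i d i)%N; set DW := (\sum_i d i * weight (e i))%N.
set MW := (\sum_i \sum_(z <- Y) \mu_z (p i) * weight (e i))%N.
set MM := (\sum_i \sum_(z <- Y) \mu_z (p i))%N; set MQ := (\sum_(z <- Y) \mu_z Q)%N.
move: (size Q).-1 (size s) M DW MW MM MQ; clear; lia.
Qed.
End AffineRolle.

(** * Moving a solution to infinity *)

Lemma prod_exprz_const (F : fieldType) (I : finType) (t : F) (a : I -> int) :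
  t != 0 -> \prod_i t ^ a i = t ^ (\sum_i a i).
Proof.
move=> t0; elim/big_ind2: _ => [|u x v y -> ->|//]; first by rewrite expr0z.
by rewrite expfzDr.
Qed.

(** This is [t^d q(x0 + 1/t)], where the coordinate [t] sends [x0] to infinity. The formal degree
    [d] is used, so a drop in the degree of [q] becomes a root at 0. *)
Definition recip_at (R : fieldType) (x0 : R) (d : nat) (q : {poly R}) : {poly R} :=
  \poly_(j < d.+1) (q \Po ('X + x0%:P))`_(d - j).

Lemma horner_recip_at (R : fieldType) (x0 t : R) (d : nat) (q : {poly R}) :
  (size q <= d.+1)%N -> t != 0 ->
  (recip_at x0 d q).[t] = t ^+ d * q.[x0 + t^-1].
Proof.
move=> sq t0; rewrite horner_poly.
have -> : q.[x0 + t^-1] = (q \Po ('X + x0%:P)).[t^-1].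
  by rewrite horner_comp !hornerE addrC.
rewrite (@horner_coef_wide _ d.+1); last by rewrite size_comp_poly2 // size_XaddC.
rewrite big_distrr /= [RHS](reindex_inj rev_ord_inj) /=.
apply: eq_bigr => j _; rewrite subSS mulrCA; congr (_ * _).
have jd : (j <= d)%N by rewrite -ltnS.
by rewrite exprVn -{2}(subnKC jd) exprD mulfK // expf_neq0.
Qed.

(** A nonzero value at [x0] becomes the leading coefficient, so the degree is exactly [d], as the
    affine bound requires. *)
Lemma lead_recip_at (R : fieldType) (x0 : R) (d : nat) (q : {poly R}) : q.[x0] != 0 ->
  size (recip_at x0 d q) = d.+1 /\ lead_coef (recip_at x0 d q) = q.[x0].
Proof.
move=> q0; have c0 : (q \Po ('X + x0%:P))`_(d - d) = q.[x0].
  by rewrite subnn -horner_coef0 horner_comp !hornerE ?add0r.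
by rewrite size_poly_eq ?c0 // lead_coef_poly ?c0.
Qed.

(* A change of projective coordinate moves one of the solutions to infinity,
   where the affine statement applies. *)
Lemma projective_rolle (R : realType) (I : finType) (p : I -> {poly R})
    (d : I -> nat) (e : I -> int) (s : seq R) (y : R) :
  (forall i, (size (p i) <= (d i).+1)%N) -> \sum_i (d i)%:Z * e i = 0 ->
  uniq s -> (0 < size s)%N ->
  {in s, forall x, (forall i, (p i).[x] != 0) /\ \prod_i (p i).[x] ^ e i = 1} ->
  (forall i, (p i).[y] != 0) -> \prod_i (p i).[y] ^ e i != 1 ->
  (size s + 2 <= \sum_i d i * weight (e i))%N.
Proof.
move=> sp de us; case: s us => // x0 s /= /andP[x0s us] _ ss y0 y1.
have [px0 ex0] := ss x0 (mem_head _ _).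
(* Factors of exponent 0 are replaced by the constant 1 of degree 0, as the affine bound
   requires. *)
pose d' i := if e i == 0 then 0%N else d i.
pose p' i := if e i == 0 then 1 else recip_at x0 (d i) (p i).
have ev (t : R) i : t != 0 ->
    (p' i).[t] ^ e i = (t ^+ d i * (p i).[x0 + t^-1]) ^ e i.
  move=> t0; rewrite /p'; case: (e i =P 0) => [->|_]; first by rewrite !expr0z.
  by rewrite horner_recip_at.
(* The powers of [t] coming from the factors cancel because the [d i * e i] add up to 0. *)
have evp (t : R) : t != 0 -> (forall i, (p i).[x0 + t^-1] != 0) ->
    \prod_i (p' i).[t] ^ e i = \prod_i (p i).[x0 + t^-1] ^ e i.
  move=> t0 pt; under eq_bigr do rewrite ev // expfzMl.
  rewrite big_split /=; under eq_bigr do rewrite exprnP exprz_exp.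
  by rewrite prod_exprz_const // de expr0z mul1r.
have ev0 (t : R) i : t != 0 -> (p i).[x0 + t^-1] != 0 -> (p' i).[t] != 0.
  move=> t0 pt; rewrite /p'; case: (e i =P 0) => _; first by rewrite hornerC oner_neq0.
  by rewrite horner_recip_at // mulf_neq0 // expf_neq0.
pose tr x : R := (x - x0)^-1.
have trE x : x != x0 -> tr x != 0 /\ x0 + (tr x)^-1 = x.
  by move=> xx; rewrite invr_eq0 subr_eq0 invrK addrC subrK.
have xs x : x \in s -> x != x0 by move=> xs; apply: contraNneq x0s => <-.
have yx0 : y != x0 by apply: contraNneq y1 => ->; rewrite ex0.
have tr_inj : {in s &, injective tr}.
  by move=> a b _ _ /invr_inj /addIr.
(* The solution [x0] is now at infinity and leaves the list, so the constant 2 becomes 3. *)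
rewrite addSn -addnS -(size_map tr).
have <- : (\sum_i d' i * weight (e i) = \sum_i d i * weight (e i))%N.
  by apply: eq_bigr => i _; rewrite /d'; case: (e i =P 0) => // ->; rewrite weight0 !muln0.
apply: (@affine_rolle _ _ p' _ _ _ _ _ _ _ (tr y)).
- move=> i; rewrite /p' /d'; case: (e i =P 0) => _; first by rewrite size_poly1.
  by have [] := lead_recip_at (d i) (px0 i).
- by move=> i; rewrite /d' => ->; rewrite eqxx.
- by rewrite -[RHS]de; apply: eq_bigr => i _; rewrite /d'; case: (e i =P 0) => // ->; rewrite !mulr0.
- rewrite -[RHS]ex0; apply: eq_bigr => i _; rewrite /p'; case: (e i =P 0) => [->|_].
    by rewrite !expr0z.
  by have [_ ->] := lead_recip_at (d i) (px0 i).
- by rewrite map_inj_in_uniq.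
- move=> _ /mapP[x xs' ->]; have [px ex] := ss x (mem_behead (s := x0 :: s) xs').
  have [t0 tx] := trE x (xs x xs'); split; last by rewrite evp ?tx.
  by move=> i; apply: ev0; rewrite ?tx.
- by have [t0 tx] := trE y yx0; move=> i; apply: ev0; rewrite ?tx.
- by have [t0 tx] := trE y yx0; rewrite evp ?tx.
Qed.

(** * Two-parameter families over an algebraically closed field *)

Section SmallPerturbation.
Variable C : numFieldType.

Lemma exists_small_notin (L : seq C) (e : C) : 0 < e ->
  exists2 h, 0 < h <= e & h \notin L.
Proof.
move=> e0; pose s := [seq e / j.+1%:R | j <- iota 0 (size L).+1].
have us : uniq s.
  rewrite map_inj_uniq ?iota_uniq // => i j /(mulfI (lt0r_neq0 e0)) /invr_inj /eqP.
  by rewrite eqr_nat => /eqP [].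
have [/allP sL|/allPn[h /mapP[j _ ->] hL]] := boolP (all (mem L) s).
  by have := uniq_leq_size us sL; rewrite size_map size_iota ltnn.
exists (e / j.+1%:R) => //; rewrite divr_gt0 ?ltr0n //=.
by rewrite ler_pdivrMr ?ltr0n // ler_pMr // ler1n.
Qed.

Lemma poly_lipschitz0 (q : {poly C}) :
  exists2 K, 0 <= K & forall h, `|h| <= 1 -> `|q.[h] - q.[0]| <= K * `|h|.
Proof.
elim/poly_ind: q => [|q c [K K0 HK]].
  by exists 0 => // h _; rewrite !hornerC subrr normr0 mul0r.
exists (`|q.[0]| + K); first by rewrite addr_ge0.
move=> h h1; rewrite !hornerE addrK normrM ler_wpM2r //.
rewrite -[q.[h]](subrK q.[0]) addrC (le_trans (ler_normD _ _)) // lerD2l.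
by rewrite (le_trans (HK h h1)) // ler_piMr.
Qed.

Lemma poly_nonzero_near0 (q : {poly C}) (b : C) : q.[0] != 0 ->
  exists2 e, 0 < e <= 1 &
    forall s t, `|s| <= e -> `|t| <= e -> q.[s] + t * b != 0.
Proof.
move=> q0; have [K K0 HK] := poly_lipschitz0 q.
(* The radius [|q.[0]| / M] makes [(K + |b|) * |q.[0]| / M] smaller than [|q.[0]|]; the summand
   [|q.[0]|] of [M] keeps the radius at most 1. *)
pose M := K + `|b| + `|q.[0]| + 1.
have M0 : 0 < M by rewrite ltr_wpDl // !addr_ge0.
have q0' : 0 < `|q.[0]| by rewrite normr_gt0.
have e1 : `|q.[0]| / M <= 1.
  by rewrite ler_pdivrMr // mul1r /M -addrA addrCA lerDl !addr_ge0.
exists (`|q.[0]| / M); first by rewrite divr_gt0.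
move=> s t se te; apply/eqP => h.
have : `|q.[0]| <= (K + `|b|) * (`|q.[0]| / M).
  have {1}-> : q.[0] = - (q.[s] - q.[0] + t * b) by rewrite addrAC h add0r opprK.
  rewrite normrN (le_trans (ler_normD _ _)) // mulrDl lerD //.
    exact: le_trans (HK s (le_trans se e1)) (ler_wpM2l K0 se).
  by rewrite normrM mulrC; apply: ler_wpM2l.
rewrite mulrA ler_pdivlMr // [X in _ <= X]mulrC ler_pM2l // /M -addrA.
by rewrite -[X in _ <= X]addr0 lerD2l lt_geF // ltr_wpDl.
Qed.

Lemma common_radius (I : eqType) (r : seq I) (P : I -> C -> Prop) :
  (forall i, exists2 e, 0 < e <= 1 & forall s, 0 <= s <= e -> P i s) ->
  exists2 e, 0 < e <= 1 & forall i, i \in r -> forall s, 0 <= s <= e -> P i s.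
Proof.
move=> H; elim: r => [|i r [e /andP[e0 e1] He]]; first by exists 1; rewrite ?ltr01 ?lexx.
have [e' /andP[e'0 e'1] He'] := H i; exists (e' * e).
  by rewrite mulr_gt0 //= mulr_ile1 // ltW.
move=> j; rewrite inE => /predU1P[->|jr] s /andP[s0 se].
  by apply: He'; rewrite s0 (le_trans se) // ler_piMr // ltW.
by apply: He => //; rewrite s0 (le_trans se) // ler_piMl // ltW.
Qed.
End SmallPerturbation.

(** A factor [X - r] with [|r| >= e] multiplies the absolute value of the constant coefficient by
    [|r|], and a bound on all coefficients by at most [1 + |r| <= (1 + e^-1) |r|]. *)
Lemma coef_le_of_no_small_root (C : numClosedFieldType) (q : {poly C}) (e : C) D m :
  0 < e -> (size q <= D)%N -> (forall t, `|t| < e -> q.[t] != 0) ->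
  `|q`_m| <= (1 + e^-1) ^+ D * `|q`_0|.
Proof.
move=> e0 sq nr.
have q0 : q != 0 by apply: contraTneq (nr 0 _) => [->|]; rewrite ?hornerC ?eqxx // normr0.
have [rs qE] := closed_field_poly_normal q.
have l0 : lead_coef q != 0 by rewrite lead_coef_eq0.
have rse : {in rs, forall r, e <= `|r|}.
  move=> r rrs; rewrite real_leNgt ?realE ?normr_ge0 ?(ltW e0) //.
  apply/negP => /nr /negP; apply; rewrite -[_ == _]/(root q r) qE.
  by rewrite rootZ // root_prod_XsubC.
have srs : (size rs <= D)%N.
  apply: leq_trans sq; move/(congr1 (fun p : {poly C} => size p)): qE.
  by rewrite size_scale // size_prod_XsubC => ->.
have e1 : 0 <= e^-1 by rewrite invr_ge0 ltW.
have e11 : 1 <= 1 + e^-1 by rewrite lerDl.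
suff H : forall k, `|(\prod_(z <- rs) ('X - z%:P))`_k| <=
    (1 + e^-1) ^+ size rs * `|(\prod_(z <- rs) ('X - z%:P))`_0|.
  rewrite qE !coefZ !normrM mulrCA ler_wpM2l //.
  by rewrite (le_trans (H m)) // ler_wpM2r // ler_weXn2l.
elim: rs rse {qE srs} => [|r rs IH] rse k.
  by rewrite big_nil !coef1 expr0 mul1r normr1; case: k => [|k] /=; rewrite ?normr0 ?normr1.
have er : e <= `|r| by apply: rse; rewrite mem_head.
have {}IH := IH (fun x xs => rse x (mem_behead (s := r :: rs) xs)).
rewrite big_cons; set P := \prod_(z <- rs) _ in IH *.
rewrite !mulrBl !coefB !coefXM !coefCM /= sub0r normrN [size _]/= exprS.
rewrite (le_trans (ler_normB _ _)) // !normrM.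
set Z := (1 + e^-1) ^+ _ in IH *.
have Z0 : 0 <= Z * `|P`_0| by rewrite mulr_ge0 // exprn_ge0 // addr_ge0.
have -> : (1 + e^-1) * Z * (`|r| * `|P`_0|) =
   e^-1 * `|r| * (Z * `|P`_0|) + `|r| * (Z * `|P`_0|) by ring.
apply: lerD; last by rewrite ler_wpM2l.
apply: (@le_trans _ _ (Z * `|P`_0|)).
  by case: k => [|k] /=; [rewrite normr0 | apply: IH].
by rewrite ler_peMl // mulrC ler_pdivlMr // mul1r.
Qed.

(* Continuity of roots: were the solutions finite in number, all roots of
   F(h, .) would stay away from 0 for small h <> 0, so that every coefficient of
   F(h, .) would be O(F(h, 0)), forcing F(0, .) = 0. *)
Lemma two_parameter_solutions (C : numClosedFieldType) (I : finType)
    (A : I -> {poly C}) (b : I -> C) (e : I -> int) (L : seq (C * C)) :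
  (forall i, (A i).[0] != 0) -> \prod_i (A i).[0] ^ e i = 1 ->
  exists2 st : C * C, st \notin L &
    (forall i, (A i).[st.1] + st.2 * b i != 0) /\
    \prod_i ((A i).[st.1] + st.2 * b i) ^ e i = 1.
Proof.
move=> A0 Ae.
have near i : exists2 r, 0 < r <= 1 & forall q, 0 <= q <= r ->
    forall s t, `|s| <= q -> `|t| <= q -> (A i).[s] + t * b i != 0.
  have [r r01 Hr] := poly_nonzero_near0 (b i) (A0 i); exists r => //.
  by move=> q /andP[_ qr] s t sq tq; apply: Hr; [apply: le_trans sq qr | apply: le_trans tq qr].
have [r /andP[r0 r1] Hr] := common_radius (enum I) near.
have {near Hr} nz i s t : `|s| <= r -> `|t| <= r -> (A i).[s] + t * b i != 0.
  by apply: Hr; rewrite ?mem_enum // lexx ltW.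
(* [F] is a polynomial in the second parameter whose coefficients are polynomials in the first; its
   zeros near the origin are solutions. *)
pose M (P : pred I) : {poly {poly C}} :=
  \prod_(i | P i) ((A i)%:P + ((b i)%:P)%:P * 'X) ^+ `|e i|.
pose F : {poly {poly C}} := M (fun i => 0 < e i) - M (fun i => e i < 0).
have evM s t P : (map_poly (horner_eval s) (M P)).[t] =
    \prod_(i | P i) ((A i).[s] + t * b i) ^+ `|e i|.
  rewrite rmorph_prod horner_prod; apply: eq_bigr => i _.
  rewrite rmorphXn horner_exp rmorphD rmorphM /= !map_polyC map_polyX /=.
  by rewrite /horner_eval hornerC !hornerE [b i * t]mulrC.
have solP s t : `|s| <= r -> `|t| <= r -> (map_poly (horner_eval s) F).[t] = 0 ->
    (forall i, (A i).[s] + t * b i != 0) /\ \prod_i ((A i).[s] + t * b i) ^ e i = 1.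
  move=> sr tr; rewrite /F rmorphB hornerD hornerN !evM => /eqP; rewrite subr_eq0 => h.
  have nzi i := nz i _ _ sr tr; split => //.
  by apply/eqP; rewrite prod_exprz_eq1.
have r0' : `|0 : C| <= r by rewrite normr0 ltW.
have rabs (h : C) : 0 < h <= r -> `|h| <= r by case/andP => h0 hr; rewrite gtr0_norm.
have F00 : (map_poly (horner_eval 0) F).[0] = 0.
  rewrite /F rmorphB hornerD hornerN !evM; apply/eqP; rewrite subr_eq0.
  rewrite -prod_exprz_eq1 => [|i]; last by rewrite mul0r addr0.
  by rewrite -[X in _ == X]Ae; apply/eqP/eq_bigr => i _; rewrite mul0r addr0.
(* When [F(0, .)] vanishes identically, every small second parameter gives a solution. *)
have [F0|F0] := eqVneq (map_poly (horner_eval 0) F) 0.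
  have [t tr tL] := exists_small_notin (map snd L) r0.
  exists (0, t); first by apply: contra tL => /(map_f snd).
  by apply: solP => //=; [exact: rabs | rewrite F0 hornerC].
have cF h k : (map_poly (horner_eval h) F)`_k = (F`_k).[h] by rewrite coef_map.
pose m := (size (map_poly (horner_eval 0) F)).-1.
have Fm : (F`_m).[0] != 0 by rewrite -cF -/(lead_coef _) lead_coef_eq0.
have Fc0 : (F`_0).[0] = 0 by rewrite -cF -horner_coef0.
have [//|no] := EM (exists2 st : C * C, st \notin L &
    (forall i, (A i).[st.1] + st.2 * b i != 0) /\
    \prod_i ((A i).[st.1] + st.2 * b i) ^ e i = 1).
have [K1 K10 H1] := poly_lipschitz0 (F`_m); have [K2 K20 H2] := poly_lipschitz0 (F`_0).
pose K := (1 + r^-1) ^+ size F.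
have K0 : 0 <= K by rewrite exprn_ge0 // addr_ge0 // invr_ge0 ltW.
have Kp : 0 < K1 + K * K2 + 1 by rewrite ltr_wpDl // addr_ge0 // mulr_ge0.
have Fm0 : 0 < `|(F`_m).[0]| by rewrite normr_gt0.
(* Chosen so that [(K1 + K * K2) * del] is smaller than [|F_m(0)|], while [del <= r]. *)
pose del := r * (`|(F`_m).[0]| / (K1 + K * K2 + 1 + `|(F`_m).[0]|)).
have Kp' : 0 < K1 + K * K2 + 1 + `|(F`_m).[0]| by rewrite addr_gt0.
have del0 : 0 < del by rewrite !(mulr_gt0, invr_gt0).
have delr : del <= r.
  apply: ler_piMr; first exact: ltW.
  by rewrite ler_pdivrMr // mul1r lerDr ltW.
have [h /andP[h0 hd] hL] := exists_small_notin (map fst L) del0.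
have hr : `|h| <= r by rewrite rabs // h0 (le_trans hd).
have h1 : `|h| <= 1 := le_trans hr r1.
(* A small root would be a solution whose first parameter [h] avoids the list. *)
have nr t : `|t| < r -> (map_poly (horner_eval h) F).[t] != 0.
  move=> tr; apply/negP => /eqP ht; apply: no; exists (h, t).
    by apply: contra hL => /(map_f fst).
  by apply: solP => //; apply: ltW.
have := coef_le_of_no_small_root m r0 (size_poly _ _) nr.
rewrite !cF -/K => le.
have : `|(F`_m).[0]| <= (K1 + K * K2) * h.
  rewrite -(subrK (F`_m).[h] (F`_m).[0]) (le_trans (ler_normD _ _)) // mulrDl lerD //.
    by rewrite distrC (le_trans (H1 _ h1)) // gtr0_norm.
  rewrite (le_trans le) // -mulrA ler_wpM2l //.
  by have := H2 _ h1; rewrite Fc0 subr0 (gtr0_norm h0).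
have ka : 0 <= K1 + K * K2 by rewrite addr_ge0 // mulr_ge0.
move=> /le_trans /(_ (ler_wpM2l ka hd)).
have -> : (K1 + K * K2) * del = `|(F`_m).[0]| * ((K1 + K * K2) * r / (K1 + K * K2 + 1 + `|(F`_m).[0]|)).
  by rewrite /del; ring.
rewrite ler_pMr // ler_pdivlMr // mul1r lt_geF //.
apply: (@le_lt_trans _ _ (K1 + K * K2)); first exact: ler_piMr.
by rewrite -addrA ltrDl addr_gt0.
Qed.

(** * Monomial coordinates on the torus *)

Section Monomials.
Variables (F : fieldType) (m : nat).
Implicit Types (x : 'I_m -> F) (a : 'rV[int]_m).

Definition monomial x a : F := \prod_i x i ^ a 0 i.

Lemma monomial_neq0 x a : (forall i, x i != 0) -> monomial x a != 0.
Proof. by move=> x0; apply/prodf_neq0 => i _; rewrite expfz_neq0. Qed.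

Lemma monomialD x a b : (forall i, x i != 0) ->
  monomial x (a + b) = monomial x a * monomial x b.
Proof.
move=> x0; rewrite /monomial -big_split /=; apply: eq_bigr => i _.
by rewrite mxE expfzDr.
Qed.

Lemma monomial0 x : monomial x 0 = 1.
Proof. by rewrite /monomial big1 // => i _; rewrite mxE expr0z. Qed.

Lemma prodrXz (I : finType) (y : I -> F) (c : int) :
  (\prod_i y i) ^ c = \prod_i y i ^ c.
Proof.
by elim/big_ind2: _ => // [|a b u v <- <-]; [rewrite exp1rz | rewrite expfzMl].
Qed.

Lemma monomialZ x c a : monomial x (c *: a) = monomial x a ^ c.
Proof.
rewrite /monomial prodrXz; apply: eq_bigr => i _.
by rewrite mxE mulrC exprz_exp.
Qed.

Lemma monomial_delta x j : monomial x (delta_mx 0 j) = x j.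
Proof.
rewrite /monomial (bigD1 j) //= big1 => [|i ij]; rewrite mxE ?eqxx /= ?(negPf ij) ?expr1z ?mulr1 //.
Qed.
End Monomials.

Lemma monomialM (F : fieldType) (m q : nat) (x : 'I_q -> F) (A : 'M[int]_(m, q)) a :
  (forall i, x i != 0) ->
  monomial (fun j => monomial x (row j A)) a = monomial x (a *m A).
Proof.
move=> x0; rewrite mulmx_sum_row /monomial.
under eq_bigr do rewrite -/(monomial _ _) -monomialZ.
elim/big_ind2: _ => // [|u b v c -> ->]; first exact/esym/monomial0.
exact/esym/monomialD.
Qed.

(** * Lattice relations and torus points of a primitive near circuit *)

Section PrimitiveData.
Variables (n k l : nat) (w : 'I_n.+1 -> 'rV[int]_n.+1).
Let W : 'M[int]_n.+1 := \matrix_i w i.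

(** The points on the last axis contribute only multiples of [l e_n]. *)
Lemma primitive_span : primitive k l w -> forall u : 'rV[int]_n.+1,
  exists a : 'rV[int]_n.+1, exists m : int, u = a *m W + (m * l%:Z) *: e_last int n.
Proof.
pose H (u : 'rV[int]_n.+1) := exists a : 'rV[int]_n.+1, exists m : int,
  u = a *m W + (m * l%:Z) *: e_last int n.
have H0 : H 0 by exists 0, 0; rewrite mul0mx mul0r scale0r addr0.
have HD u v : H u -> H v -> H (u + v).
  move=> [a [m ->]] [b [m' ->]]; exists (a + b), (m + m').
  by rewrite mulmxDl mulrDl scalerDl addrACA.
have HZ u c : H u -> H (u *~ c).
  move=> [a [m ->]]; exists (c *: a), (c * m).
  by rewrite -scaler_int intz scalerDr scalemxAl scalerA mulrA.
have Hw i : H (w i).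
  by exists (delta_mx 0 i), 0; rewrite mul0r scale0r addr0 -rowE rowK.
have He j : H ((j * l)%N%:Z *: e_last int n).
  by exists 0, j%:Z; rewrite mul0mx add0r PoszM.
move=> prim u; have [a ->] := prim u.
elim/big_ind: _ => // i _; apply: HZ.
have : (in_tuple (near_circuit_points k l w))`_i \in near_circuit_points k l w.
  by rewrite mem_nth.
rewrite mem_cat => /orP[/mapP[j _ ->] //|/codomP[j ->] //].
Qed.

Variables (kappa : 'rV[int]_n.+1) (N : int).
Hypotheses (kW : kappa *m W = (- N) *: e_last int n)
  (bez : exists rho : 'cV[int]_n.+1, (kappa *m rho) 0 0 = 1).

(** By primitivity the matrix of the [v_i] has full rank, so its left kernel over the rationals is a
    line. The multiple is an integer because the vector [rho] takes [kappa] to 1. *)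
Lemma relation_multiple : primitive k l w -> forall (a : 'rV[int]_n.+1) c,
  a *m W = c *: e_last int n -> exists q, a = q *: kappa.
Proof.
move=> prim a c aW; have [rho krho] := bez.
pose V : 'M[int]_(n.+1, n) := col' ord_max W.
have colV (b : 'rV[int]_n.+1) d : b *m W = d *: e_last int n -> b *m V = 0.
  move=> bW; apply/rowP => j; have /rowP/(_ (lift ord_max j)) := bW.
  rewrite !mxE [_ == ord_max]eq_sym (negPf (neq_lift _ _)) andbF mulr0 => bW0; rewrite -[RHS]bW0.
  by apply: eq_bigr => i _; rewrite !mxE.
pose Vq : 'M[rat]_(n.+1, n) := map_mx intr V.
have full : row_full Vq.
  have /choice[b bP] : forall j : 'I_n, exists b : 'rV[int]_n.+1, b *m V = delta_mx 0 j.
    move=> j; have [b [m em]] := primitive_span prim (delta_mx 0 (lift ord_max j)).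
    exists b; apply/rowP => i; have /rowP/(_ (lift ord_max i)) := em.
    rewrite !mxE [_ == ord_max]eq_sym (negPf (neq_lift _ _)) andbF mulr0 addr0.
    rewrite (inj_eq lift_inj) => ->.
    by apply: eq_bigr => h _; rewrite !mxE.
  apply/row_fullP; exists (map_mx intr (\matrix_j b j)).
  rewrite -map_mxM -[RHS](map_mx1 (intr : {rmorphism int -> rat})); congr map_mx.
  by apply/row_matrixP => j; rewrite row_mul rowK bP row1.
have rk : \rank (kermx Vq) = 1%N.
  by rewrite mxrank_ker (eqP full) subSnn.
pose kq : 'rV[rat]_n.+1 := map_mx intr kappa.
have kk : (kq <= kermx Vq)%MS.
  by apply/sub_kermxP; rewrite -map_mxM (colV _ _ kW) map_mx0.
have kq0 : kq != 0.
  apply/eqP => k0; have : (kappa *m rho) 0 0 != 0 by rewrite krho.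
  have -> : kappa = 0.
    apply/rowP => i; move/rowP/(_ i): k0; rewrite /kq !mxE => /eqP.
    by rewrite intr_eq0 => /eqP.
  by rewrite mul0mx mxE eqxx.
have ka : ((map_mx intr a : 'rV[rat]_n.+1) <= kermx Vq)%MS.
  by apply/sub_kermxP; rewrite -map_mxM (colV _ _ aW) map_mx0.
have kle : (kermx Vq <= kq)%MS.
  by rewrite -(mxrank_leqif_sup kk) rk rank_rV kq0.
have /sub_rVP[d ad] := submx_trans ka kle.
have dE : d = ((a *m rho) 0 0)%:~R.
  transitivity (d * ((kappa *m rho) 0 0)%:~R); first by rewrite krho mulr1.
  have ev (b : 'rV[int]_n.+1) : ((b *m rho) 0 0)%:~R =
      (map_mx intr b *m map_mx intr rho : 'M[rat]_1) 0 0 by rewrite -map_mxM [RHS]mxE.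
  by rewrite !ev ad -scalemxAl [RHS]mxE.
exists ((a *m rho) 0 0); apply/rowP => i; apply: (@intr_inj rat).
rewrite [(_ *: kappa) _ _]mxE intrM -dE; move/rowP/(_ i): ad.
by rewrite /kq !mxE.
Qed.

(** Compare last coordinates in an expression of [e_n], whose coefficients on the [w i] form a
    multiple of [kappa]. This makes [N] odd when [l] is even. *)
Lemma primitive_coprime : primitive k l w -> exists q m : int, m * l%:Z - q * N = 1.
Proof.
move=> prim; have [a [m em]] := primitive_span prim (e_last int n).
have [q aq] : exists q, a = q *: kappa.
  apply: (relation_multiple prim (c := 1 - m * l%:Z)).
  by rewrite scalerBl scale1r {1}em addrK.
exists q, m; move: em => /rowP /(_ ord_max).
rewrite aq -scalemxAl kW scalerA !mxE !eqxx /= !mulr1; lia.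
Qed.

Section Torus.
Variable F : fieldType.
Hypothesis prim : primitive k l w.

Lemma monomial_e_last (x : 'I_n.+1 -> F) c : monomial x (c *: e_last int n) = x ord_max ^ c.
Proof. by rewrite monomialZ monomial_delta. Qed.

Lemma monomial_mulW (x : 'I_n.+1 -> F) a : (forall i, x i != 0) ->
  monomial x (a *m W) = monomial (fun i => monomial x (w i)) a.
Proof.
move=> x0; rewrite -monomialM //; apply: eq_bigr => i _; by rewrite rowK.
Qed.

(** Primitivity makes every coordinate a monomial in the last coordinate and the values at the
    [w i]. *)
Lemma torus_point_unique (x y : 'I_n.+1 -> F) :
  (forall i, x i != 0) -> (forall i, y i != 0) -> x ord_max = y ord_max ->
  (forall i, monomial x (w i) = monomial y (w i)) -> x =1 y.
Proof.
move=> x0 y0 xy ww j; rewrite -(monomial_delta x) -(monomial_delta y).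
have [a [m ->]] := primitive_span prim (delta_mx 0 j).
rewrite !monomialD // !monomial_e_last xy !monomial_mulW //; congr (_ * _).
by apply: eq_bigr => i _; rewrite ww.
Qed.

Lemma torus_point_relation (x : 'I_n.+1 -> F) : (forall i, x i != 0) ->
  x ord_max ^ N * monomial (fun i => monomial x (w i)) kappa = 1.
Proof.
by move=> x0; rewrite -monomial_mulW // kW monomial_e_last -expfzDr // subrr expr0z.
Qed.

(** Each coordinate is prescribed by an expression of its basis vector. The choice of expression
    does not matter: two of them differ by a multiple of the relation [kappa], whose value is 1 by
    assumption. *)
Lemma torus_point_exists (z : 'I_n.+1 -> F) (t : F) :
  (forall i, z i != 0) -> t != 0 -> t ^ N * monomial z kappa = 1 ->
  exists x : 'I_n.+1 -> F, [/\ forall i, x i != 0, x ord_max = t &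
    forall i, monomial x (w i) = z i].
Proof.
move=> z0 t0 rel.
have key a M c : a *m W + (M * l%:Z) *: e_last int n = c *: e_last int n ->
    monomial z a * t ^ (M * l%:Z) = t ^ c.
  move=> eq1; have aW : a *m W = (c - M * l%:Z) *: e_last int n.
    by rewrite scalerBl -eq1 addrK.
  have [q aq] := relation_multiple prim aW.
  have -> : M * l%:Z = q * N + c.
    move/rowP/(_ ord_max): aW; rewrite aq -scalemxAl kW scalerA !mxE !eqxx /= !mulr1.
    by move=> h; rewrite -[LHS](subrK c) -opprB -h; ring.
  rewrite aq monomialZ expfzDr // [q * N]mulrC -exprz_exp mulrA -expfzMl.
  by rewrite [monomial _ _ * _]mulrC rel exp1rz mul1r.
have /choice[am amP] : forall j, exists am : 'rV[int]_n.+1 * int,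
    delta_mx 0 j = am.1 *m W + (am.2 * l%:Z) *: e_last int n.
  by move=> j; have [a [m ?]] := primitive_span prim (delta_mx 0 j); exists (a, m).
pose A : 'M[int]_n.+1 := \matrix_j (am j).1.
pose x j := monomial z (am j).1 * t ^ ((am j).2 * l%:Z).
have x0 j : x j != 0 by rewrite mulf_neq0 ?monomial_neq0 ?expfz_neq0.
have xE b : monomial x b = monomial z (b *m A) * t ^ ((\sum_j b 0 j * (am j).2) * l%:Z).
  rewrite -monomialM // big_distrl /= -prod_exprz_const // -big_split /=.
  apply: eq_bigr => j _; rewrite /x expfzMl rowK; congr (_ * _).
  by rewrite exprz_exp mulrC mulrA.
have bE b : b = (b *m A) *m W + ((\sum_j b 0 j * (am j).2) * l%:Z) *: e_last int n.
  rewrite {1}(row_sum_delta b) (mulmx_sum_row b A) mulmx_suml.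
  rewrite big_distrl scaler_suml -big_split /=; apply: eq_bigr => j _.
  by rewrite {1}amP scalerDr scalerA -scalemxAl rowK mulrA.
exists x; split => //.
  by rewrite /x (key _ _ 1) ?expr1z // scale1r -amP.
move=> i; rewrite xE.
have := key (w i *m A - delta_mx 0 i) (\sum_j w i 0 j * (am j).2) 0.
rewrite expr0z scale0r mulmxBl addrAC -bE -rowE rowK subrr => /(_ erefl).
rewrite monomialD // -scaleN1r monomialZ monomial_delta exprN1 mulrAC => h.
by rewrite -[RHS]mul1r -h divfK.
Qed.
End Torus.
End PrimitiveData.

(** * Reduction to a linear system *)

Section System.
Variables (R : realType) (n k l : nat) (w : 'I_n.+1 -> 'rV[int]_n.+1).

(** The same [c] and [g] serve for every field over [R], so the real and the complex solutions come
    from one linear system. *)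
Lemma laurent_eval_near_circuit (f : laurent R n.+1) :
  {subset finsupp f <= near_circuit_points k l w} ->
  exists (c : 'I_n.+1 -> R) (g : {poly R}), (size g <= k.+1)%N /\
  forall (F : fieldType) (phi : {rmorphism R -> F}) (x : 'rV[F]_n.+1),
    (forall i, x 0 i != 0) ->
    laurent_eval phi f x =
    \sum_i phi (c i) * monomial (x 0) (w i) + (map_poly phi g).[x 0 ord_max ^+ l].
Proof.
rewrite /laurent_eval => fC.
suff H (s : seq 'rV[int]_n.+1) : {subset s <= near_circuit_points k l w} ->
  exists (c : 'I_n.+1 -> R) (g : {poly R}), (size g <= k.+1)%N /\
  forall (F : fieldType) (phi : {rmorphism R -> F}) (x : 'rV[F]_n.+1),
    (forall i, x 0 i != 0) ->
    \sum_(a <- s) phi (f a) * \prod_i x 0 i ^ a 0 i =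
    \sum_i phi (c i) * monomial (x 0) (w i) + (map_poly phi g).[x 0 ord_max ^+ l].
  by have [c [g [sg E]]] := H (finsupp f) fC; exists c, g.
elim: s {fC} => [|a s IH] sC.
  exists (fun=> 0), 0; rewrite size_poly0; split => // F phi x _.
  rewrite big_nil map_poly0 hornerC addr0 big1 // => i _.
  by rewrite rmorph0 mul0r.
have [c [g [sg E]]] := IH (fun y ys => sC y (mem_behead (s := a :: s) ys)).
have := sC a (mem_head _ _); rewrite mem_cat => /orP[/mapP[j]|/codomP[i ai]].
  rewrite mem_iota add0n => /andP[_ jk] aj.
  exists c, (g + (f a)%:P * 'X^j); split.
    rewrite (leq_trans (size_polyD _ _)) // geq_max sg.
    rewrite (leq_trans (size_polyMleq _ _)) // size_polyXn addnS /=.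
    by rewrite (leq_trans _ jk) // -(add1n j) leq_add2r size_polyC leq_b1.
  move=> F phi x x0; rewrite big_cons E // rmorphD rmorphM /= map_polyC map_polyXn.
  rewrite hornerD hornerM hornerC hornerXn addrCA; congr (_ + _).
  rewrite addrC; congr (_ + _ * _).
  rewrite -[LHS]/(monomial (x 0) a) aj monomial_e_last -exprnP.
  by rewrite mulnC exprM.
exists (fun h => c h + (h == i)%:R * f a), g; split => // F phi x x0.
rewrite big_cons E // addrA; congr (_ + _).
rewrite -[X in phi (f a) * X]/(monomial (x 0) a) ai.
under [RHS]eq_bigr do rewrite rmorphD rmorphM rmorph_nat mulrDl.
rewrite big_split /= addrC; congr (_ + _).
rewrite (bigD1 i) //= eqxx mul1r big1 ?addr0 // => h /negPf ->.
by rewrite !mul0r.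
Qed.

Variables (B : 'M[R]_n.+1) (g : 'I_n.+1 -> {poly R}).
Variables (kappa : 'rV[int]_n.+1) (N : int).

Definition rhs (F : fieldType) (phi : {rmorphism R -> F}) (u : F) : 'rV[F]_n.+1 :=
  \row_j (map_poly phi (g j)).[u].

(** The pair stands for [x_n] and the values [x^{w_i}]; for a primitive near circuit the third
    condition describes the image of the torus. *)
Definition reduced_solution (F : fieldType) (phi : {rmorphism R -> F}) (tz : F * 'rV[F]_n.+1) :=
  [/\ tz.1 != 0, forall i, tz.2 0 i != 0, tz.1 ^ N * monomial (tz.2 0) kappa = 1 &
    tz.2 *m map_mx phi B + rhs phi (tz.1 ^+ l) = 0].

Hypotheses (prim : primitive k l w)
  (kW : kappa *m (\matrix_i w i) = (- N) *: e_last int n)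
  (bez : exists rho : 'cV[int]_n.+1, (kappa *m rho) 0 0 = 1).
Variable f : 'I_n.+1 -> laurent R n.+1.
Hypothesis fE : forall (F : fieldType) (phi : {rmorphism R -> F}) (x : 'rV[F]_n.+1),
    (forall i, x 0 i != 0) -> forall j,
    laurent_eval phi (f j) x =
    \sum_i phi (B i j) * monomial (x 0) (w i) + (map_poly phi (g j)).[x 0 ord_max ^+ l].

Definition reduce (F : fieldType) (x : 'rV[F]_n.+1) : F * 'rV[F]_n.+1 :=
  (x 0 ord_max, \row_i monomial (x 0) (w i)).

Lemma reduce_inj (F : fieldType) (x y : 'rV[F]_n.+1) :
  (forall i, x 0 i != 0) -> (forall i, y 0 i != 0) -> reduce x = reduce y -> x = y.
Proof.
move=> x0 y0 [xy /rowP ww]; apply/rowP.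
apply: (torus_point_unique prim) => // i.
by have := ww i; rewrite !mxE.
Qed.

Lemma reduced_system (F : fieldType) (phi : {rmorphism R -> F}) (x : 'rV[F]_n.+1) :
  (forall i, x 0 i != 0) ->
  (forall j, laurent_eval phi (f j) x = 0) <->
  (reduce x).2 *m map_mx phi B + rhs phi ((reduce x).1 ^+ l) = 0.
Proof.
move=> x0.
have E j : laurent_eval phi (f j) x =
    ((reduce x).2 *m map_mx phi B + rhs phi ((reduce x).1 ^+ l)) 0 j.
  rewrite fE // !mxE; congr (_ + _); apply: eq_bigr => i _; rewrite !mxE mulrC //.
by split => [h|h j]; [apply/rowP => j; rewrite -E h mxE | rewrite E h mxE].
Qed.

Lemma reduced_solution_reduce (F : fieldType) (phi : {rmorphism R -> F}) (x : 'rV[F]_n.+1) :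
  torus_solutions phi f x -> reduced_solution phi (reduce x).
Proof.
move=> [x0 /(reduced_system phi x0) sx]; split => //=.
- by move=> i; rewrite mxE monomial_neq0.
- rewrite -[RHS](torus_point_relation kW x0); congr (_ * _).
  by apply: eq_bigr => i _; rewrite mxE.
Qed.

Lemma reduced_solution_lift (F : fieldType) (phi : {rmorphism R -> F}) tz :
  reduced_solution phi tz -> exists2 x : 'rV[F]_n.+1,
    torus_solutions phi f x & reduce x = tz.
Proof.
case: tz => t z [/= t0 z0 rel sys].
have [x [x0 xt xz]] := torus_point_exists kW bez prim z0 t0 rel.
have x0' i : (\row_i x i : 'rV[F]_n.+1) 0 i != 0 by rewrite mxE.
have rx : reduce (\row_i x i : 'rV[F]_n.+1) = (t, z).
  rewrite /reduce mxE xt; congr (_, _); apply/rowP => i; rewrite mxE -xz.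
  by apply: eq_bigr => j _; rewrite mxE.
by exists (\row_i x i) => //; split => //; apply/(reduced_system phi x0'); rewrite rx.
Qed.

Lemma finite_reduced_solutions (F : fieldType) (phi : {rmorphism R -> F}) (r : nat) :
  torus_solutions phi f #= `I_r ->
  exists P : seq (F * 'rV[F]_n.+1), [/\ uniq P, size P = r &
    forall tz, reduced_solution phi tz <-> tz \in P].
Proof.
move=> Sr.
have fin : finite_set (torus_solutions phi f) by exists r.
have [X EX] := finite_fsetP.1 fin.
have sX : size X = r by move: Sr; rewrite EX => /card_eq_fsetP.
have XP x : x \in (X : seq _) <-> torus_solutions phi f x by rewrite EX.
exists [seq reduce x | x <- X]; split; rewrite ?size_map //.
  rewrite map_inj_in_uniq ?fset_uniq // => x y /XP[x0 _] /XP[y0 _].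
  exact: reduce_inj.
move=> tz; split => [/reduced_solution_lift[x /XP xX <-]|/mapP[x /XP xX ->]].
  exact: map_f.
exact: reduced_solution_reduce.
Qed.
End System.

(** * Parity of l *)

Lemma exprz_odd_opp (F : fieldType) (x : F) (N : int) : odd `|N|%N -> (- x) ^ N = - x ^ N.
Proof.
move=> oN; rewrite -mulN1r expfzMl -[RHS]mulN1r; congr (_ * _).
case: N oN => m om; first by rewrite -exprnP -signr_odd om.
rewrite NegzE -exprnN -signr_odd; move: om; rewrite /absz => ->.
by rewrite expr1 invrN1.
Qed.

Section Parity.
Variables (R : rcfType) (l : nat) (N : int).
Hypotheses (l0 : (0 < l)%N) (lN : ~~ odd l -> odd `|N|%N).

(** For [l] odd, [t ^ l] can be any real number, for [l] even any nonnegative one; the exponent 1 or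
    2 gives the simplest power map with the same range. *)
Definition parity_exp : nat := if odd l then 1 else 2.
Local Notation q := parity_exp.

Lemma eq_expr_abs (t t' : R) : t ^+ l = t' ^+ l -> (t == t') || (t == - t').
Proof.
move=> tt; rewrite -eqr_norm2 -(@eqrXn2 _ l) //.
by rewrite -!normrX tt.
Qed.

Lemma eq_expr_odd (t t' : R) : odd l -> t ^+ l = t' ^+ l -> t = t'.
Proof.
move=> ol tt; case/orP: (eq_expr_abs tt) => /eqP // tE.
move: tt; rewrite tE exprNn -signr_odd ol expr1 mulN1r => /eqP.
rewrite eq_sym -subr_eq0 opprK -mulr2n mulrn_eq0 /= expf_eq0 l0 /= => /eqP ->.
by rewrite oppr0.
Qed.

(** For [l] even, [t] is known only up to sign, and squaring removes that sign from [t ^ N]. *)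
Lemma parity_exp_eq (t t' : R) : t ^+ l = t' ^+ l -> (t ^ N) ^+ q = (t' ^ N) ^+ q.
Proof.
rewrite /parity_exp; case: ifPn => ol tt; first by rewrite (eq_expr_odd ol tt).
case/orP: (eq_expr_abs tt) => /eqP -> //.
by rewrite exprz_odd_opp ?lN // sqrrN.
Qed.

Lemma parity_exp1 (x : R) : x ^+ l = 1 -> x ^+ q = 1.
Proof.
move=> xl; rewrite /parity_exp; case: ifPn => ol.
  by rewrite expr1; apply: eq_expr_odd ol _; rewrite expr1n.
have : x ^+ l = 1 ^+ l by rewrite expr1n.
by move/eq_expr_abs => /orP[] /eqP ->; rewrite ?sqrrN expr1n.
Qed.

(** For [l] even, a value -1 becomes 1 on replacing [t0] by [- t0], because [N] is odd. *)
Lemma parity_solution (t0 M : R) : t0 != 0 -> (t0 ^ N * M) ^+ q = 1 ->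
  exists t, [/\ t != 0, t ^+ l = t0 ^+ l & t ^ N * M = 1].
Proof.
move=> t00; rewrite /parity_exp; case: ifPn => ol.
  by rewrite expr1 => h; exists t0.
move/eqP; rewrite -subr_eq0 subr_sqr_1 mulf_eq0 subr_eq0 addr_eq0 => /orP[] /eqP h.
  by exists t0.
exists (- t0); rewrite oppr_eq0 t00 exprNn -signr_odd (negPf ol) expr0 mul1r.
by rewrite exprz_odd_opp ?lN // mulNr h opprK.
Qed.

Lemma parity_unique (t t' M : R) : t ^+ l = t' ^+ l ->
  t ^ N * M = 1 -> t' ^ N * M = 1 -> t = t'.
Proof.
have [ol|ol] := boolP (odd l) => tt h h'; first exact: eq_expr_odd ol tt.
case/orP: (eq_expr_abs tt) => /eqP // tE.
move: h; rewrite tE exprz_odd_opp ?lN // mulNr h' => /eqP.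
by rewrite eq_sym -subr_eq0 opprK -mulr2n pnatr_eq0.
Qed.

Definition parity_root (u : R) : R := if odd l then u else Num.sqrt u.

Lemma parity_rootK (t : R) : parity_root (t ^+ l) ^+ q = t ^+ l.
Proof.
rewrite /parity_root /parity_exp; case: ifPn => ol; first by rewrite expr1.
by rewrite sqr_sqrtr // exprn_even_ge0.
Qed.

(** For [l] even the values are positive and each has two square roots, told apart by their sign. *)
Lemma parity_root_list (u : seq R) : uniq u ->
  {in u, forall x, exists2 t, t != 0 & x = t ^+ l} ->
  exists s : seq R, [/\ uniq s, size s = (q * size u)%N &
    {in s, forall x, x ^+ q \in u}].
Proof.
move=> uu ut.
have rK : {in u, forall x, parity_root x ^+ q = x}.
  by move=> x /ut[t _ ->]; rewrite parity_rootK.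
have us1 : uniq (map parity_root u).
  rewrite map_inj_in_uniq // => x y xu yu xy.
  by rewrite -(rK x xu) -(rK y yu) xy.
have [ol|ol] := boolP (odd l).
  exists (map parity_root u); split => //.
    by rewrite size_map /parity_exp ol mul1n.
  by move=> _ /mapP[x xu ->]; rewrite rK.
have pos : {in u, forall x, 0 < parity_root x}.
  move=> x /ut[t t0 ->]; rewrite /parity_root (negPf ol) sqrtr_gt0.
  by rewrite exprn_even_gt0 // t0 orbT.
exists (map parity_root u ++ map -%R (map parity_root u)); split.
- rewrite cat_uniq us1 map_inj_uniq ?us1 ?andbT; last exact: oppr_inj.
  apply/hasPn => _ /mapP[_ /mapP[x xu ->] ->]; apply/negP => /mapP[y yu /eqP].
  by rewrite lt_eqF // (lt_trans _ (pos y yu)) // oppr_lt0 pos.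
- by rewrite size_cat !size_map /parity_exp (negPf ol) mul2n addnn.
- move=> y; rewrite mem_cat => /orP[/mapP[x xu ->]|/mapP[_ /mapP[x xu ->] ->]].
    by rewrite rK.
  have := rK x xu; rewrite /parity_exp (negPf ol) sqrrN => ->.
  exact: xu.
Qed.
End Parity.

Lemma exists_pos_nonroot (R : rcfType) (p : {poly R}) : p != 0 ->
  exists2 t, 0 < t & p.[t] != 0.
Proof.
move=> p0; exists (cauchy_bound p); first exact: cauchy_bound_gt0.
by apply: (ge_cauchy_bound p0); rewrite in_itv /= lexx.
Qed.

(** * Counting the solutions of the reduced system *)

Section Counting.
Variables (R : realType) (n k l : nat).
Variables (B : 'M[R]_n.+1) (g : 'I_n.+1 -> {poly R}).
Variables (kappa : 'rV[int]_n.+1) (N : int).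
Hypotheses (l0 : (0 < l)%N) (lN : ~~ odd l -> odd `|N|%N)
  (sg : forall j, (size (g j) <= k.+1)%N).
Variable P : seq (R * 'rV[R]_n.+1).
Hypotheses (uP : uniq P) (P0 : (0 < size P)%N)
  (PP : forall tz, reduced_solution l B g kappa N (idfun : {rmorphism R -> R}) tz <-> tz \in P).
Local Notation q := (parity_exp l).

Let D : int := \sum_i kappa 0 i.

Lemma map_idfun (p : {poly R}) : map_poly idfun p = p.
Proof. exact: map_poly_id. Qed.

Lemma rhsE u : rhs g (idfun : {rmorphism R -> R}) u = \row_j (g j).[u].
Proof. by apply/rowP => j; rewrite !mxE map_idfun. Qed.

Lemma reduced_solutionE t z : (t, z) \in P <->
  [/\ t != 0, forall i, z 0 i != 0, t ^ N * monomial (z 0) kappa = 1 &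
    z *m B + \row_j (g j).[t ^+ l] = 0].
Proof.
rewrite -PP; split; case=> /= t0 z0 rel sys; split => //.
  by rewrite -sys rhsE; congr (_ *m _ + _); apply/matrixP => i j; rewrite mxE.
by rewrite -[RHS]sys rhsE; congr (_ *m _ + _); apply/matrixP => i j; rewrite mxE.
Qed.

Lemma avoid_list (p : {poly R}) : p != 0 ->
  exists t, [/\ 0 < t, p.[t] != 0 & forall tz, tz \in P -> tz.1 ^+ l != t ^+ l].
Proof.
move=> p0; pose a := p * \prod_(tz <- P) ('X^l - (tz.1 ^+ l)%:P).
have Xl0 (c : R) : 'X^l - c%:P != 0.
  by rewrite -size_poly_gt0 size_XnsubC.
have a0 : a != 0.
  by rewrite mulf_neq0 //; rewrite prodf_seq_neq0; apply/allP => tz _ /=; rewrite Xl0.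
have [t t0 at0] := exists_pos_nonroot a0; exists t.
move: at0; rewrite /a hornerM mulf_eq0 negb_or => /andP[pt h]; split => //.
move=> tz tzP; move: h; rewrite horner_prod; apply: contraNneq => tzt.
rewrite prodf_seq_eq0; apply/hasP; exists tz => //=.
by rewrite hornerD hornerN hornerC hornerXn tzt subrr.
Qed.

(** Inverting [B] makes [z] a vector of polynomials of degree at most [k] in [u = t ^ l]. With
    [u = x ^ q] the relation becomes one equation in [x], with [q] solutions for each element of
    [P]. *)
Lemma count_invertible : B \in unitmx ->
  (q * size P + 2 <= q * k * (\sum_i weight (l%:Z * kappa 0 i)%R) +
     weight ((q : nat)%:Z * N)%R + weight (- ((q : nat)%:Z * (N + k%:Z * l%:Z * D)))%R)%N.
Proof.
move=> Bu.
pose h i : {poly R} := - \sum_j invmx B j i *: g j.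
have sh i : (size (h i) <= k.+1)%N.
  rewrite size_polyN; apply: (leq_trans (size_sum _ _ _)); apply/bigmax_leqP => j _.
  by rewrite (leq_trans (size_scale_leq _ _)).
have hE z u : z *m B + \row_j (g j).[u] = 0 <-> z = \row_i (h i).[u].
  have hu : \row_i (h i).[u] = - (\row_j (g j).[u] *m invmx B).
    apply/rowP => i; rewrite !mxE hornerN horner_sum; congr (- _).
    by apply: eq_bigr => j _; rewrite hornerZ mxE mulrC.
  rewrite hu; split => [/eqP|->]; last by rewrite mulNmx mulmxKV // addNr.
  by rewrite addr_eq0 => /eqP zB; rewrite -mulNmx -zB mulmxK.
pose U := [seq tz.1 ^+ l | tz <- P].
have solP t z : (t, z) \in P -> [/\ t != 0, z = \row_i (h i).[t ^+ l],
    forall i, (h i).[t ^+ l] != 0 & t ^ N * \prod_i (h i).[t ^+ l] ^ kappa 0 i = 1].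
  move=> /reduced_solutionE [t0 z0 rel /hE zE]; split => //.
    by move=> i; have := z0 i; rewrite zE mxE.
  by rewrite -[RHS]rel; congr (_ * _); apply: eq_bigr => i _; rewrite zE mxE.
have uU : uniq U.
  rewrite map_inj_in_uniq // => -[t z] [t' z'] /solP[t0 zE _ rel] /solP[t'0 z'E _ rel'] /= tt.
  by rewrite zE z'E -tt; congr (_, _); apply: (parity_unique l0 lN tt rel); rewrite tt.
have [|s [us ss sU]] := @parity_root_list _ l _ uU.
  by move=> _ /mapP[[t z] /solP[t0 _ _ _] ->]; exists t.
(* The relation is raised to the power [l] to involve only [x ^ q = t ^ l]. The index [inl true] is
   the factor [X]; [inl false] is the constant 1 with formal degree 1, which records the order at
   infinity and makes the sum of the [d i * e i] vanish. *)
pose I := (bool + 'I_n.+1)%type.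
pose p (i : I) : {poly R} := match i with
  | inl true => 'X | inl false => 1 | inr i => h i \Po 'X^q end.
pose d (i : I) : nat := match i with inl _ => 1 | inr i => q * k end.
pose e (i : I) : int := match i with
  | inl true => (q : nat)%:Z * N | inl false => - ((q : nat)%:Z * (N + k%:Z * l%:Z * D))
  | inr i => l%:Z * kappa 0 i end.
have q0 : (0 < q)%N by rewrite /parity_exp; case: ifP.
have prodE x : \prod_i (p i).[x] ^ e i =
    x ^ ((q : nat)%:Z * N) * (\prod_i (h i).[x ^+ q] ^ kappa 0 i) ^+ l.
  rewrite big_sumType big_bool /= hornerX !hornerC exp1rz mulr1; congr (_ * _).
  rewrite [RHS]exprnP prodrXz; apply: eq_bigr => i _.
  by rewrite horner_comp hornerXn mulrC exprz_exp.
have prodE' t x : x ^+ q = t ^+ l -> \prod_i (p i).[x] ^ e i =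
    (t ^ N * \prod_i (h i).[t ^+ l] ^ kappa 0 i) ^+ l.
  move=> xt; rewrite prodE xt exprMn; congr (_ * _).
  by rewrite -exprz_exp -exprnP xt [RHS]exprnP exprnP !exprz_exp mulrC.
have nzE x t : t != 0 -> x ^+ q = t ^+ l ->
    (forall i, (h i).[t ^+ l] != 0) -> forall i, (p i).[x] != 0.
  move=> t0 xt ht [[]|i] /=; rewrite ?hornerX ?hornerC ?oner_neq0 //.
    by apply: contraNneq t0 => x0; move/esym/eqP: xt; rewrite x0 expr0n gtn_eqF //= expf_eq0 l0.
  by rewrite horner_comp hornerXn xt.
have [[y [y0 y1]]|nowit] := EM (exists y, (forall i, (p i).[y] != 0) /\ \prod_i (p i).[y] ^ e i != 1).
  have sumE : (\sum_i d i * weight (e i) = q * k * (\sum_i weight (l%:Z * kappa 0 i)%R) +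
      weight ((q : nat)%:Z * N)%R + weight (- ((q : nat)%:Z * (N + k%:Z * l%:Z * D)))%R)%N.
    rewrite big_sumType big_bool /= !mul1n [LHS]addnC addnA -big_distrr /=; reflexivity.
  rewrite -sumE -[(q * size P)%N](congr1 (muln q) (size_map (fun tz => tz.1 ^+ l) P)) -ss.
  apply: projective_rolle us _ _ y0 y1.
  - case=> [[]|i] /=; rewrite ?size_polyX ?size_poly1 //.
    have : (size (h i \Po 'X^q) <= ((size (h i)).-1 * (size ('X^q : {poly R})).-1).+1)%N.
      by rewrite size_comp_poly_leq.
    move=> /leq_trans -> //; rewrite ltnS size_polyXn /= mulnC leq_mul2l.
    by apply/orP; right; move: (sh i); case: (size (h i)).
  - rewrite big_sumType big_bool /= !mul1r; under eq_bigr do rewrite mulrA.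
    rewrite -big_distrr /= -/D !PoszM; ring.
  - by rewrite ss size_map muln_gt0 q0.
  - move=> x /sU /mapP[[t z] /solP[t0 _ ht rel] xt]; split; first exact: nzE t0 xt ht.
    by rewrite (prodE' _ _ xt) rel expr1n.
(* Now the equation holds wherever its factors do not vanish, and a point chosen away from the list
   yields a solution missing from it. *)
exfalso.
have hi0 i : h i != 0.
  have [[t z] /solP[_ _ /(_ i) hi _]] : exists tz, tz \in P.
    by case: (P) P0 => // a ? _; exists a; rewrite mem_head.
  by apply: contraNneq hi => ->; rewrite hornerC.
have a0 : \prod_i (h i \Po 'X^l) != 0.
  apply/prodf_neq0 => i _; rewrite comp_poly_eq0 ?hi0 //.
  by rewrite size_polyXn ltnS.
have [t [t0 ht tP]] := avoid_list a0.
have ht' i : (h i).[t ^+ l] != 0.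
  move: ht; rewrite horner_prod => /prodf_neq0/(_ i isT).
  by rewrite horner_comp hornerXn.
have t0' : t != 0 by rewrite gt_eqF.
have xq : parity_root l (t ^+ l) ^+ q = t ^+ l by exact: parity_rootK.
have one : (t ^ N * \prod_i (h i).[t ^+ l] ^ kappa 0 i) ^+ l = 1.
  rewrite -(prodE' _ _ xq); apply/eqP/negP => /negP h1; apply: nowit.
  by exists (parity_root l (t ^+ l)); split => //; apply: nzE t0' xq ht'.
have [t' [t'0 tt rel]] := parity_solution lN t0' (parity_exp1 l0 one).
have /tP /eqP : (t', \row_i (h i).[t ^+ l]) \in P.
  apply/reduced_solutionE; split => //; last by rewrite tt; apply/hE.
    by move=> i; rewrite mxE.
  by rewrite -[RHS]rel; congr (_ * _); apply: eq_bigr => i _; rewrite mxE.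
by [].
Qed.

(* With z confined to the line z0 + s b over each value of t^l, the relation is
   again an equation between products of linear forms, now in s. *)
Lemma count_kernel_line (b : 'rV[R]_n.+1) (Q : {poly R}) :
  b != 0 -> b *m B = 0 -> (forall c : 'rV[R]_n.+1, c *m B = 0 -> (c <= b)%MS) ->
  Q != 0 -> (size Q <= k.+1)%N -> (forall tz, tz \in P -> root Q (tz.1 ^+ l)) ->
  (size P <= k * (\sum_i weight ((q : nat)%:Z * kappa 0 i)%R +
                  weight (- ((q : nat)%:Z * D))%R - 2))%N.
Proof.
move=> b0 bB kerb Q0 sQ rQ; set M := (_ - 2)%N.
(* [Q] has at most [k] roots, so it suffices to bound the number of solutions over each value of
   [t ^ l]. *)
suff fiber u : (size [seq tz <- P | tz.1 ^+ l == u] <= M)%N.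
  have cover (us : seq R) (P' : seq (R * 'rV[R]_n.+1)) :
      (forall u, (size [seq tz <- P' | tz.1 ^+ l == u] <= M)%N) ->
      (forall tz, tz \in P' -> tz.1 ^+ l \in us) -> (size P' <= size us * M)%N.
    elim: us P' => [|u us IH] P' fib inus.
      by case: P' {fib} inus => // a P' /(_ a (mem_head _ _)).
    rewrite -(count_predC (fun tz => tz.1 ^+ l == u)) mulSn -!size_filter.
    apply: leq_add; first exact: fib.
    apply: IH => [v|tz].
      apply: leq_trans (fib v); rewrite -filter_predI !size_filter.
      by apply: sub_count => tz /= /andP[].
    by rewrite mem_filter /= => /andP[/negPf nu /inus]; rewrite inE nu.
  pose us := undup [seq tz.1 ^+ l | tz <- P].
  apply: (@leq_trans (size us * M)).
    by apply: cover => // tz tzP; rewrite mem_undup; apply/mapP; exists tz.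
  rewrite leq_mul2r; apply/orP; right; rewrite -ltnS.
  apply: leq_trans sQ; apply: max_poly_roots => //; last exact: undup_uniq.
  by apply/allP => x; rewrite mem_undup => /mapP[tz tzP ->]; apply: rQ.
set Pu := [seq tz <- P | _].
have [->//|Pu0] := eqVneq Pu [::].
have [[t0 z0] tz0u] : exists tz, tz \in Pu.
  by case: (Pu) Pu0 => // a ? _; exists a; rewrite mem_head.
have PuP t z : (t, z) \in Pu <-> [/\ t ^+ l = u, t != 0, forall i, z 0 i != 0,
    t ^ N * monomial (z 0) kappa = 1 & z *m B + \row_j (g j).[u] = 0].
  rewrite mem_filter; split.
    by move=> /andP[/eqP tu /reduced_solutionE []]; rewrite tu.
  by case=> tu *; rewrite tu eqxx; apply/reduced_solutionE; split; rewrite ?tu.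
have [t0u t00 z00 rel0 sys0] := (PuP _ _).1 tz0u.
have [i0 bi0] : exists i, b 0 i != 0 by apply/rV0Pn.
(* The coordinate of a solution on the line, read off in a component where [b] is nonzero. *)
pose par (tz : R * 'rV[R]_n.+1) : R := (tz.2 0 i0 - z0 0 i0) / b 0 i0.
have parE t z : (t, z) \in Pu -> z = z0 + par (t, z) *: b.
  move=> /PuP[_ _ _ _ sys].
  have /kerb /sub_rVP[s sE] : (z - z0) *m B = 0.
    by rewrite mulmxBl -[z *m B](addrK (\row_j (g j).[u])) sys sub0r
      -[z0 *m B](addrK (\row_j (g j).[u])) sys0 sub0r subrr.
  have -> : par (t, z) = s.
    rewrite /par /=; have /rowP/(_ i0) := sE; rewrite !mxE => ->.
    by rewrite mulfK.
  by rewrite -sE addrC subrK.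
have uS : uniq (map par Pu).
  rewrite map_inj_in_uniq ?filter_uniq // => -[t z] [t' z'] h h' pp.
  have zz : z = z' by rewrite (parE _ _ h) (parE _ _ h') pp.
  move: h h' => /PuP[tu _ _ rel _] /PuP[tu' _ _ rel' _]; rewrite -zz in rel' *.
  by congr (_, _); apply: (parity_unique l0 lN _ rel rel'); rewrite tu tu'.
(* Over a fixed [u] the power [(t ^ N) ^ q] is constant, hence a factor of degree 0; [inl false]
   again records the order at infinity. *)
pose I := (bool + 'I_n.+1)%type.
pose p (i : I) : {poly R} := match i with
  | inl true => (t0 ^ N)%:P | inl false => 1 | inr i => (z0 0 i)%:P + b 0 i *: 'X end.
pose d (i : I) : nat := match i with inl true => 0 | _ => 1 end.
pose e (i : I) : int := match i with
  | inl true => (q : nat)%:Z | inl false => - ((q : nat)%:Z * D)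
  | inr i => (q : nat)%:Z * kappa 0 i end.
have zE s i : (p (inr i)).[s] = (z0 + s *: b) 0 i.
  by rewrite /= !hornerE !mxE mulrC.
have prodE s : \prod_i (p i).[s] ^ e i =
    (t0 ^ N * monomial ((z0 + s *: b) 0) kappa) ^+ q.
  have pF : (p (inl false)).[s] = 1 by exact: hornerC.
  have pT : (p (inl true)).[s] = t0 ^ N by exact: hornerC.
  have bigE (F : I -> R) : \prod_i F i = F (inl true) * F (inl false) * \prod_i F (inr i).
    by rewrite big_sumType big_bool.
  rewrite bigE pF pT exp1rz mulr1 exprMn; congr (_ * _).
  rewrite [RHS]exprnP prodrXz; apply: eq_bigr => i _.
  by rewrite zE [e _]mulrC exprz_exp.
have nzE s : (forall i, (z0 + s *: b) 0 i != 0) -> forall i, (p i).[s] != 0.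
  by move=> h [[]|i]; rewrite ?zE // hornerC ?oner_neq0 // expfz_neq0.
have [[y [y0 y1]]|nowit] := EM (exists y, (forall i, (p i).[y] != 0) /\ \prod_i (p i).[y] ^ e i != 1).
  have sumE : (\sum_i d i * weight (e i) = \sum_i weight ((q : nat)%:Z * kappa 0 i)%R +
                  weight (- ((q : nat)%:Z * D))%R)%N.
    rewrite big_sumType big_bool /= mul0n add0n mul1n addnC; congr (_ + _)%N.
    by apply: eq_bigr => i _; rewrite mul1n.
  suff : (size (map par Pu) + 2 <= \sum_i d i * weight (e i))%N.
    rewrite size_map sumE /M; move: (size Pu) (\sum_i _)%N (weight _) => a c b'.
    by clear; lia.
  apply: projective_rolle uS _ _ y0 y1.
  - case=> [[]|i] /=; rewrite ?size_poly1 ?size_polyC ?leq_b1 //.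
    rewrite (leq_trans (size_polyD _ _)) // geq_max size_polyC (leq_trans (leq_b1 _)) //.
    by rewrite (leq_trans (size_scale_leq _ _)) // size_polyX.
  - rewrite big_sumType big_bool /= mul0r add0r mul1r; under eq_bigr do rewrite mul1r.
    by rewrite -big_distrr /= -/D addNr.
  - by rewrite size_map lt0n size_eq0.
  - move=> _ /mapP[[t z] h ->]; rewrite prodE -(parE _ _ h); move: (h) => /PuP[tu _ z0' rel _].
    split; first by apply: nzE; rewrite -(parE _ _ h).
    have tt : t0 ^+ l = t ^+ l by rewrite tu t0u.
    by rewrite exprMn (parity_exp_eq l0 lN tt) -exprMn rel expr1n.
(* If the equation held identically, a new parameter [s] would give a solution missing from the
   list. *)
exfalso.
pose a := (\prod_i p (inr i)) * \prod_(s <- map par Pu) ('X - s%:P).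
have a0 : a != 0.
  rewrite mulf_neq0 //.
    apply/prodf_neq0 => i _; apply: contraNneq (z00 i) => pi0.
    by have := zE 0 i; rewrite pi0 hornerC scale0r addr0 => <-.
  by rewrite prodf_seq_neq0; apply/allP => s _ /=; rewrite polyXsubC_eq0.
have [s _] := exists_pos_nonroot a0.
rewrite /a hornerM mulf_eq0 negb_or horner_prod => /andP[/prodf_neq0 hs sS].
have zs i : (z0 + s *: b) 0 i != 0 by rewrite -zE hs.
have one : (t0 ^ N * monomial ((z0 + s *: b) 0) kappa) ^+ q = 1.
  rewrite -prodE; apply/eqP/negP => /negP h1; apply: nowit.
  by exists s; split => //; apply: nzE.
have [t' [t'0 tt rel]] := parity_solution lN t00 one.
have h : (t', z0 + s *: b) \in Pu.
  apply/PuP; split => //; first by rewrite tt.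
  by rewrite mulmxDl -scalemxAl bB scaler0 addr0.
move/negP: sS; apply; rewrite horner_prod prodf_seq_eq0; apply/hasP.
exists s; last by rewrite /= hornerXsubC subrr.
apply/mapP; exists (t', z0 + s *: b) => //.
by rewrite /par /= !mxE [z0 0 i0 + _]addrC addrK mulfK.
Qed.
End Counting.

(** * Excluding two-parameter families of complex solutions *)

Lemma preimage_seq (S T : eqType) (F : S -> T) (s : seq T) : injective F ->
  exists L : seq S, forall x, F x \in s -> x \in L.
Proof.
move=> Finj; elim: s => [|a s [L HL]]; first by exists [::].
have [[x Fx]|no] := EM (exists x, F x = a).
  exists (x :: L) => y; rewrite !inE => /orP[/eqP|/HL ->]; last by rewrite orbT.
  by rewrite -Fx => /Finj ->; rewrite eqxx.
exists L => y; rewrite inE => /orP[/eqP Fy|/HL //].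
by case: no; exists y.
Qed.

Section Finiteness.
Variables (R : realType) (n l : nat).
Variables (B : 'M[R]_n.+1) (g : 'I_n.+1 -> {poly R}).
Variables (kappa : 'rV[int]_n.+1) (N : int).
Variables (C : numClosedFieldType) (phi : {rmorphism R -> C}).
Variable Pc : seq (C * 'rV[C]_n.+1).
Hypothesis PcP : forall tz, reduced_solution l B g kappa N phi tz -> tz \in Pc.

(** The linear system holds along the whole family, so only the multiplicative relation has to be
    solved. It has a solution outside any finite list of parameters, and injectivity puts the
    resulting point outside [Pc]. *)
Lemma no_two_parameter_family (T : {poly C}) (A : 'I_n.+1 -> {poly C}) (b : 'rV[C]_n.+1)
    (pt := fun st : C * C => (T.[st.1], \row_i ((A i).[st.1] + st.2 * b 0 i))) :
  T.[0] != 0 -> (forall i, (A i).[0] != 0) ->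
  T.[0] ^ N * \prod_i (A i).[0] ^ kappa 0 i = 1 ->
  (forall st, (pt st).2 *m map_mx phi B + rhs g phi ((pt st).1 ^+ l) = 0) ->
  injective pt -> False.
Proof.
move=> T0 A0 rel sys ptI.
have [L HL] := preimage_seq Pc ptI.
pose I := (bool + 'I_n.+1)%type.
pose A' (i : I) : {poly C} := match i with inl true => T | inl false => 1 | inr i => A i end.
pose b' (i : I) : C := match i with inl _ => 0 | inr i => b 0 i end.
pose e (i : I) : int := match i with inl true => N | inl false => 0 | inr i => kappa 0 i end.
have bigE (F : I -> C) : \prod_i F i = F (inl true) * F (inl false) * \prod_i F (inr i).
  by rewrite big_sumType big_bool.
have [||st stL [nz rel']] := @two_parameter_solutions C I A' b' e L.
- by case=> [[]|i] //=; rewrite hornerC oner_neq0.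
- by rewrite bigE /= expr0z mulr1.
move/negP: stL; apply; apply/HL/PcP; split => //=.
- by have := nz (inl true); rewrite /= mulr0 addr0.
- by move=> i; have := nz (inr i); rewrite mxE.
- rewrite -[RHS]rel' bigE /= expr0z mulr0 addr0 mulr1; congr (_ * _).
  by apply: eq_bigr => i _; rewrite mxE.
- exact: sys st.
Qed.

Variables (t0 : R) (z0 : 'rV[R]_n.+1).
Hypotheses (t00 : t0 != 0) (z00 : forall i, z0 0 i != 0)
  (rel0 : t0 ^ N * monomial (z0 0) kappa = 1)
  (sys0 : z0 *m B + \row_j (g j).[t0 ^+ l] = 0).

Let relC : phi t0 ^ N * \prod_i phi (z0 0 i) ^ kappa 0 i = 1.
Proof.
rewrite -[RHS](rmorph1 phi) -rel0 rmorphM rmorph_prod fmorphXz; congr (_ * _).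
by apply: eq_bigr => i _; rewrite fmorphXz.
Qed.

Lemma rhs_morph (u : R) : rhs g phi (phi u) = map_mx phi (\row_j (g j).[u]).
Proof. by apply/rowP => j; rewrite !mxE horner_map. Qed.

(** If [c] were not a multiple of [b], the points [z0 + s c + t b] over the fixed [t0] would form an
    excluded family. *)
Lemma kernel_line (b c : 'rV[R]_n.+1) : b != 0 -> b *m B = 0 -> c *m B = 0 -> (c <= b)%MS.
Proof.
move=> b0 bB cB; apply/negP => /negP cb.
apply: (@no_two_parameter_family (phi t0)%:P
  (fun i => (phi (z0 0 i))%:P + phi (c 0 i) *: 'X) (map_mx phi b)).
- by rewrite hornerC fmorph_eq0.
- by move=> i; rewrite !hornerE ?mulr0 ?addr0 fmorph_eq0.
- by rewrite hornerC -[RHS]relC; congr (_ * _); apply: eq_bigr => i _; rewrite !hornerE ?mulr0 ?addr0.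
- move=> [s t] /=; rewrite hornerC -rmorphXn rhs_morph.
  have -> : \row_i (((phi (z0 0 i))%:P + phi (c 0 i) *: 'X).[s] + t * (map_mx phi b) 0 i) =
      map_mx phi z0 + s *: map_mx phi c + t *: map_mx phi b.
    by apply/rowP => i; rewrite !mxE !hornerE [phi (c 0 i) * s]mulrC.
  rewrite !mulmxDl -!scalemxAl -!map_mxM bB cB !map_mx0 !scaler0 !addr0.
  by rewrite -map_mxD sys0 map_mx0.
- move=> [s t] [s' t'] /= [_ /rowP h].
  have hh i : (s - s') * phi (c 0 i) = (t' - t) * phi (b 0 i).
    have := h i; rewrite !mxE !hornerE => /eqP.
    by rewrite -subr_eq0 => /eqP h0; apply/eqP; rewrite -subr_eq0 -h0; apply/eqP; ring.
  have [i bi] : exists i, b 0 i != 0 by apply/rV0Pn.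
  have ss : s = s'.
    apply/eqP; rewrite -subr_eq0; apply: contraNT cb => s0.
    rewrite -(map_submx phi); apply/sub_rVP; exists ((t' - t) / (s - s')).
    apply/rowP => j; rewrite !mxE mulrAC -hh mulrAC mulfV // mul1r //.
  congr (_, _) => //; have := hh i; rewrite ss subrr mul0r => /esym/eqP.
  by rewrite mulf_eq0 fmorph_eq0 (negPf bi) orbF subr_eq0 => /eqP.
Qed.

(** The columns of the cokernel express solvability of the linear system. Were these conditions
    identities in [u], both [t] and a kernel direction could vary, again giving two parameters. *)
Lemma singular_coker_neq0 : B \notin unitmx ->
  exists m, \sum_j cokermx B j m *: g j != 0.
Proof.
move=> Bs; have [//|no] := EM (exists m, \sum_j cokermx B j m *: g j != 0).
exfalso.
have ck m : \sum_j cokermx B j m *: g j = 0.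
  by apply/eqP/negP => /negP h; apply: no; exists m.
have [b bB b0] : exists2 b : 'rV[R]_n.+1, b *m B = 0 & b != 0.
  have : kermx B != 0 by rewrite kermx_eq0 row_free_unit.
  by case/rowV0Pn => b /sub_kermxP bB b0; exists b.
(* Applied to each coefficient, the pseudoinverse of [B] gives a polynomial solution of the linear
   system. *)
pose a i : {poly R} := - \sum_j pinvmx B j i *: g j.
have aE m : \sum_i B i m *: a i = - g m.
  apply/polyP => d; pose v : 'rV[R]_n.+1 := \row_j (g j)`_d.
  have vB : (v <= B)%MS.
    rewrite submxE; apply/eqP/rowP => m'.
    rewrite [RHS]mxE; have /polyP/(_ d) := ck m'; rewrite coef0 coef_sum => <-.
    by rewrite mxE; apply: eq_bigr => j _; rewrite mxE coefZ mulrC.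
  have /rowP/(_ m) := mulmxKpV vB; rewrite [v 0 m]mxE coefN => <-.
  rewrite coef_sum !mxE -sumrN; apply: eq_bigr => i _.
  rewrite coefZ coefN coef_sum mulrN mulrC; congr (- (_ * _)); rewrite mxE.
  by apply: eq_bigr => j _; rewrite coefZ !mxE mulrC.
pose u0 := t0 ^+ l.
(* The added constants form a kernel vector; they make the family pass through [(t0, z0)] at the
   origin. *)
pose A i : {poly C} := (map_poly phi (a i)) \Po (('X + (phi t0)%:P) ^+ l) +
  (phi (z0 0 i - (a i).[u0]))%:P.
have AE s i : (A i).[s] = (map_poly phi (a i)).[(s + phi t0) ^+ l] + phi (z0 0 i - (a i).[u0]).
  by rewrite /A hornerD horner_comp hornerC horner_exp hornerD hornerX hornerC.
have A0 i : (A i).[0] = phi (z0 0 i).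
  by rewrite AE add0r -rmorphXn horner_map rmorphB addrC subrK.
apply: (@no_two_parameter_family ('X + (phi t0)%:P) A (map_mx phi b)).
- by rewrite hornerD hornerX hornerC add0r fmorph_eq0.
- by move=> i; rewrite A0 fmorph_eq0.
- rewrite hornerD hornerX hornerC add0r -[RHS]relC; congr (_ * _).
  by apply: eq_bigr => i _; rewrite A0.
- move=> [s t] /=; rewrite hornerD hornerX hornerC.
  have aC u : (\row_i (map_poly phi (a i)).[u]) *m map_mx phi B = - rhs g phi u.
    apply/rowP => m; rewrite !mxE -hornerN -rmorphN -aE rmorph_sum horner_sum.
    by apply: eq_bigr => i _; rewrite !mxE /= map_polyZ hornerZ mulrC.
  have -> : \row_i ((A i).[s] + t * map_mx phi b 0 i) =
      \row_i (map_poly phi (a i)).[(s + phi t0) ^+ l] +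
      map_mx phi (z0 - \row_i (a i).[u0]) + t *: map_mx phi b.
    by apply/rowP => i; rewrite !mxE AE.
  rewrite !mulmxDl aC -scalemxAl -!map_mxM bB map_mx0 scaler0 addr0.
  have -> : (z0 - \row_i (a i).[u0]) *m B = 0.
    have aR : (\row_i (a i).[u0]) *m B = - (\row_j (g j).[u0]).
      apply/rowP => m; rewrite !mxE -hornerN -aE horner_sum.
      by apply: eq_bigr => i _; rewrite !mxE hornerZ mulrC.
    by rewrite mulmxBl aR opprK.
  by rewrite map_mx0 addr0 addNr.
- move=> [s t] [s' t'] /= []; rewrite !hornerD !hornerX !hornerC => /addIr <- /rowP h.
  congr (_, _); have [i bi] : exists i, b 0 i != 0 by apply/rV0Pn.
  have := h i; rewrite !mxE => /addrI /mulIf; apply.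
  by rewrite fmorph_eq0.
Qed.
End Finiteness.

(** * The bounds *)

Lemma weight_le2 e : (weight e <= 2 * (e != 0%R))%N.
Proof. by rewrite /weight; case: eqP => //= _; case: ifP. Qed.

Lemma weight_odd_mul (l : nat) e : odd l -> weight (l%:Z * e)%R = weight e.
Proof.
move=> ol; have l0 : (0 < l)%N by case: l ol.
by rewrite /weight mulf_eq0 eqz_nat (gtn_eqF l0) /= pmulr_rlt0 // abszM oddM ol.
Qed.

Section MainCount.
Variables (R : realType) (n k l : nat) (w : 'I_n.+1 -> 'rV[int]_n.+1).
Variables (kappa : 'rV[int]_n.+1) (N : int).
Hypotheses (k0 : (0 < k)%N) (l0 : (0 < l)%N) (prim : primitive k l w)
  (kW : kappa *m (\matrix_i w i) = (- N) *: e_last int n)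
  (bez : exists rho : 'cV[int]_n.+1, (kappa *m rho) 0 0 = 1).
Variables (f : 'I_n.+1 -> laurent R n.+1) (r : nat).
Hypotheses (supp : has_support f (near_circuit_points k l w))
  (gen : generic_system f (near_circuit_points k l w))
  (real_r : real_solutions f #= `I_r).

Let D : int := \sum_i kappa 0 i.

Lemma even_l_odd_N : ~~ odd l -> odd `|N|%N.
Proof.
move=> el; have [q [m qm]] := primitive_coprime kW bez prim.
apply: contraT => eN.
have : (2 %| m * l%:Z - q * N)%Z.
  rewrite rpredB //; apply: dvdz_mull; rewrite dvdzE /=; rewrite dvdn2 //.
by rewrite qm.
Qed.

(** The cases are [B] invertible and [B] singular. In the second, a real solution serves as base
    point, and genericity enters through the finiteness of the complex solution set. *)
Lemma count_alternatives : (0 < r)%N ->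
  let q := parity_exp l in
  (q * r + 2 <= q * k * (\sum_i weight (l%:Z * kappa 0 i)%R) +
     weight (q%:Z * N)%R + weight (- (q%:Z * (N + k%:Z * l%:Z * D)))%R)%N \/
  (r <= k * (\sum_i weight (q%:Z * kappa 0 i)%R + weight (- (q%:Z * D))%R - 2))%N.
Proof.
move=> r0 q.
have /choice[c cP] := fun j => laurent_eval_near_circuit (@supp j).
have /choice[g gP] := cP.
have sg j : (size (g j) <= k.+1)%N by have [] := gP j.
pose B : 'M[R]_n.+1 := \matrix_(i, j) c j i.
have fE (F : fieldType) (phi : {rmorphism R -> F}) (x : 'rV[F]_n.+1) :
    (forall i, x 0 i != 0) -> forall j, laurent_eval phi (f j) x =
    \sum_i phi (B i j) * monomial (x 0) (w i) + (map_poly phi (g j)).[x 0 ord_max ^+ l].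
  move=> x0 j; have [_ ->] := gP j => //; congr (_ + _).
  by apply: eq_bigr => i _; rewrite mxE.
have [P [uP sP PP]] := finite_reduced_solutions prim kW bez fE (phi := idfun : {rmorphism R -> R}) real_r.
have [d cd _] := gen.
have [Pc [_ _ PcP]] := finite_reduced_solutions prim kW bez fE (phi := real_complex R : {rmorphism R -> R[i]}) cd.
have P0 : (0 < size P)%N by rewrite sP.
have lN := even_l_odd_N.
have [Bu|Bs] := boolP (B \in unitmx).
  by left; rewrite -sP; apply: (count_invertible l0 lN sg uP P0 PP Bu).
right; rewrite -sP.
have [[t0 z0] tz0P] : exists tz, tz \in P.
  by case: (P) P0 => // a ? _; exists a; rewrite mem_head.
have [t00 z00 rel0 sys0] := (reduced_solutionE PP t0 z0).1 tz0P.
have PcP' tz : reduced_solution l B g kappa N (real_complex R : {rmorphism R -> R[i]}) tz -> tz \in Pc.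
  by move/PcP.
have [m Qm] := singular_coker_neq0 PcP' t00 z00 rel0 sys0 Bs.
have [b bB b0] : exists2 b : 'rV[R]_n.+1, b *m B = 0 & b != 0.
  have : kermx B != 0 by rewrite kermx_eq0 row_free_unit.
  by case/rowV0Pn => b /sub_kermxP bB b0; exists b.
apply: (count_kernel_line l0 lN uP PP b0 bB _ Qm).
- move=> a aB; exact: (kernel_line PcP' t00 z00 rel0 sys0 b0 bB aB).
- apply: (leq_trans (size_sum _ _ _)); apply/bigmax_leqP => j _.
  by rewrite (leq_trans (size_scale_leq _ _)).
- move=> [t z] /(reduced_solutionE PP) [_ _ _ sys] /=.
  have : (\row_j (g j).[t ^+ l]) *m cokermx B = 0.
    have -> : \row_j (g j).[t ^+ l] = - (z *m B) by apply/eqP; rewrite -addr_eq0 addrC sys.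
    by rewrite mulNmx -mulmxA mulmx_coker mulmx0 oppr0.
  move/rowP/(_ m); rewrite [RHS]mxE [LHS]mxE => h.
  rewrite rootE horner_sum -[X in _ == X]h; apply/eqP; apply: eq_bigr => j _.
  by rewrite hornerZ [(\row__ _) _ _]mxE mulrC.
Qed.

Lemma kappa_neq0 : exists i, kappa 0 i != 0.
Proof.
apply/rV0Pn/eqP => k0'; have [rho] := bez.
by rewrite k0' mul0mx mxE => /eqP; rewrite eq_sym oner_eq0.
Qed.

(** [kappa] has a nonzero entry; if its entries add up to 0 it has a second one, and otherwise
    [m * D] contributes. *)
Lemma weight_kappa_ge2 (m : int) : m != 0 ->
  (2 <= \sum_i weight (kappa 0 i)%R + weight (m * D)%R)%N.
Proof.
move=> m0; have [i ki] := kappa_neq0.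
rewrite (bigD1 i) //=; have wi : (0 < weight (kappa 0 i)%R)%N by rewrite weight_gt0.
have [D0|D0] := eqVneq D 0.
  have : (0 < \sum_(j | j != i) weight (kappa 0 j)%R)%N.
    apply: leq_trans (weight_sum _ _ _); rewrite weight_gt0.
    have := D0; rewrite /D (bigD1 i) //= => /eqP; rewrite addr_eq0 => /eqP kE.
    by rewrite -oppr_eq0 -kE.
  by move=> h; apply: leq_trans (leq_addr _ _); apply: (leq_add wi h).
have : (0 < weight (m * D)%R)%N by rewrite weight_gt0 mulf_neq0.
by move=> h; apply: leq_trans (leq_add wi h) _; rewrite -addnA leq_add2l leq_addl.
Qed.

(** The singular alternative implies the same bound: by subadditivity the weight of [- k l D] is at
    most the sum of the last two weights, and it is compared with the weight of [- D], which is at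
    most 2. *)
Lemma count_odd : odd l ->
  (r + 2 <= k * (\sum_i weight (kappa 0 i)%R) + weight N +
    weight (- (N + k%:Z * l%:Z * D))%R)%N.
Proof.
move=> ol.
have sub : (weight (- (k%:Z * l%:Z) * D)%R <= weight N + weight (- (N + k%:Z * l%:Z * D))%R)%N.
  have -> : - (k%:Z * l%:Z) * D = N + - (N + k%:Z * l%:Z * D) by ring.
  exact: weightD.
have kl0 : - (k%:Z * l%:Z) != 0 by rewrite oppr_eq0 mulf_neq0 // eqz_nat gtn_eqF.
have ge2 := weight_kappa_ge2 kl0.
(* The alternatives presuppose a solution, so for [r = 0] the right-hand side is bounded below
   directly. *)
have [r0|r0] := posnP r.
  rewrite r0; set S := (\sum_i _)%N in ge2 *; move: ge2 sub; clear -k0.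
  move: (weight _) (weight N) (weight _) => a b c; nia.
have /= := count_alternatives r0; rewrite /parity_exp ol !mul1n !mul1r => -[h|h].
  move: h; under eq_bigr do rewrite weight_odd_mul //.
  by rewrite ?mul1r.
have h' : (r <= k * (\sum_i weight (kappa 0 i)%R + weight (- D)%R - 2))%N.
  by move: h; under eq_bigr do rewrite mul1r.
have kl1 : 0 < k%:Z * l%:Z by rewrite mulr_gt0 // ltz_nat.
have klD : - (k%:Z * l%:Z) * D = (k%:Z * l%:Z) * - D by ring.
rewrite klD in sub.
(* Multiplication by the positive [k l] keeps the sign and cannot make an even number odd, so weight
   2 persists. *)
have w2 : (weight (- D)%R = 2 -> weight ((k%:Z * l%:Z) * - D)%R = 2)%N.
  rewrite /weight; case: eqP => // /eqP D0 wD; rewrite mulf_eq0 (gt_eqF kl1) (negPf D0) orbF.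
  rewrite pmulr_rlt0 // abszM oddM; move: wD.
  by case: (- D < 0) => //=; case: (odd `|- D|) => //; rewrite andbF.
have w1 : (weight (- D)%R = 1 -> 0 < weight ((k%:Z * l%:Z) * - D)%R)%N.
  move=> wD; rewrite weight_gt0; apply: mulf_neq0; first by rewrite gt_eqF.
  by rewrite -weight_gt0 wD.
have w3 : (weight (- D)%R <= 2)%N by rewrite (leq_trans (weight_le2 _)) //; case: (_ != _).
move: sub w1 w2 w3 h' r0 k0; clear.
move: (weight _) (weight _) (weight (- D)%R) (weight _) (\sum_i _)%N => a b c d S.
move=> h1 h2 h3 h4 h5 r0 k0.
have hS : (2 < S + c)%N by nia.
have h6 : (r + k * 2 <= k * S + k * c)%N by rewrite -mulnDr -leq_subRL; nia.
have [c0|c1|c2] : [\/ c = 0, c = 1 | c = 2]%N by move: h4; case: (c) => [|[|[|]]] //; constructor.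
- by move: h6; rewrite c0; nia.
- by move: (h2 c1) h6; rewrite c1; nia.
- by move: (h3 c2) h6; rewrite c2; nia.
Qed.

(** All weights are at most 2 and a zero exponent weighs nothing. With [c] nonzero exponents, the
    invertible case gives [2 r + 2 <= 4 k c + 4], the source of the final 1. *)
Lemma count_even : ~~ odd l -> (r <= 2 * k * #|[pred i | kappa 0%R i != 0%R]| + 1)%N.
Proof.
move=> el.
have [->//|r0] := posnP r.
have cards (F : int -> int) : (forall e, F e != 0 -> e != 0) ->
    (\sum_i weight (F (kappa 0 i))%R <= 2 * #|[pred i | kappa 0%R i != 0%R]|)%N.
  move=> HF; rewrite -sum1_card big_distrr /= [X in (_ <= X)%N]big_mkcond /=; apply: leq_sum => i _.
  rewrite inE; apply: leq_trans (weight_le2 _) _; have := HF (kappa 0 i).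
  by case: eqP => // _; case: eqP => // h1 h2; move: (h2 isT).
have mulr_neq0 (m e : int) : m * e != 0 -> e != 0 by rewrite mulf_eq0 negb_or => /andP[].
have w2 e : (weight e <= 2)%N by rewrite (leq_trans (weight_le2 _)) //; case: (_ != _).
have := count_alternatives r0; rewrite /= /parity_exp (negPf el) => -[].
  have := cards (fun e => l%:Z * e) (@mulr_neq0 l%:Z).
  have := w2 (2%N%:Z * N); have := w2 (- (2%N%:Z * (N + k%:Z * l%:Z * D))).
  move: (weight _) (weight _) (\sum_i _)%N #|_| => a b S c; clear; nia.
have := cards (fun e => 2%N%:Z * e) (@mulr_neq0 2%N%:Z).
have := w2 (- (2%N%:Z * D)).
move: (weight _) (\sum_i _)%N #|_| => a S c; clear; nia.
Qed.
End MainCount.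

(** * Weights of the signed relation *)

Lemma oddzE a : oddz a = odd `|a|%N.
Proof. by rewrite /oddz dvdzE dvdn2 negbK. Qed.

Lemma weight_oppn (m : nat) : (weight (- m%:Z))%:Z = overline m%:Z.
Proof.
rewrite /weight /overline oppr_eq0 oppr_lt0 oddzE abszN eqz_nat ltz_nat.
by case: m => //= m; case: ifP.
Qed.

Lemma weight_pos (m : nat) : (0 < m)%N -> weight m%:Z = 2.
Proof. by rewrite /weight eqz_nat ltz_nat; case: m. Qed.

Section SignedRelation.
Variables (n k l : nat) (w : 'I_n.+1 -> 'rV[int]_n.+1).
Variables (p nu : nat) (lam : 'I_n.+1 -> nat).
Hypothesis data : associated_data w p nu lam.

(** These are the exponents of the [z_i], with the sign for which the factor [t^N] completes their
    monomial to 1. The final 0 discards the values of [lam] from [nu] on. *)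
Definition signed_relation : 'rV[int]_n.+1 :=
  \row_i (if (i < p)%N then (lam i)%:Z else if (i < nu)%N then - (lam i)%:Z else 0).
Local Notation kappa := signed_relation.

Lemma big_signed_relation (V : zmodType) (F : 'I_n.+1 -> int -> V) : (forall i, F i 0 = 0) ->
  \sum_i F i (kappa 0 i) =
  \sum_(i < n.+1 | (i < p)%N) F i (lam i)%:Z +
  \sum_(i < n.+1 | (p <= i < nu)%N) F i (- (lam i)%:Z).
Proof.
move=> F0; have [/andP[pnu _] _ _ _ _] := data.
rewrite (bigID (fun i : 'I_n.+1 => (i < p)%N)) /=; congr (_ + _).
  by apply: eq_bigr => i ip; rewrite mxE ip.
rewrite (bigID (fun i : 'I_n.+1 => (i < nu)%N)) /= [X in _ + X]big1 ?addr0.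
  apply: congr_big => // [i|i /andP[/negPf ip inu]]; first by rewrite -leqNgt.
  by rewrite mxE ip inu.
by move=> i /andP[/negPf ip /negPf inu]; rewrite mxE ip inu.
Qed.

Lemma signed_relation_sum (x : 'I_n.+1 -> int) :
  \sum_i kappa 0 i * x i =
  \sum_(i < n.+1 | (i < p)%N) (lam i)%:Z * x i -
  \sum_(i < n.+1 | (p <= i < nu)%N) (lam i)%:Z * x i.
Proof.
rewrite (big_signed_relation (F := fun i a => a * x i)) => [|i]; last by rewrite mul0r.
by congr (_ + _); rewrite -sumrN; apply: eq_bigr => i _; rewrite mulNr.
Qed.

Lemma signed_relationW : kappa *m (\matrix_i w i) = (- assoc_N w p nu lam) *: e_last int n.
Proof.
have [_ _ _ rel _] := data.
apply/rowP => j; rewrite mxE.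
under eq_bigr do rewrite [(\matrix__ _) _ _]mxE.
rewrite signed_relation_sum !mxE eqxx /=.
have [->|] := eqVneq j ord_max; first by rewrite mulr1 /assoc_N opprB.
rewrite mulr0 eq_sym => jmax; case/unlift_some: jmax => j' -> _.
apply/eqP; rewrite subr_eq0; apply/eqP.
have /rowP/(_ j') := rel; rewrite !summxE.
have E (P : pred 'I_n.+1) : \sum_(i | P i) (v_part w i *+ lam i) 0 j' =
    \sum_(i | P i) (lam i)%:Z * w i 0 (lift ord_max j').
  by apply: eq_bigr => i _; rewrite mulmxnE mxE -mulr_natl natz.
by rewrite !E.
Qed.

(** The values of [kappa] on integer vectors are closed under gcd, and each [lam i] with [i < nu] is
    among them. *)
Lemma signed_relation_bezout : exists rho : 'cV[int]_n.+1, (kappa *m rho) 0 0 = 1.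
Proof.
have [_ _ gcd1 _ _] := data.
pose G (m : nat) := exists rho : 'cV[int]_n.+1, (kappa *m rho) 0 0 = m%:Z.
suff : G 1%N by [].
rewrite -gcd1; elim/big_ind: _ => [|a b [ra ea] [rb eb]|i inu].
- by exists 0; rewrite mulmx0 mxE.
- have [u [v uv]] := Bezoutz a b; exists (u *: ra + v *: rb).
  by rewrite mulmxDr -!scalemxAr mxE [X in X + _]mxE [X in _ + X]mxE ea eb uv.
exists ((-1) ^+ (i >= p)%N *: delta_mx i 0).
rewrite -scalemxAr mxE -colE !mxE inu.
by case: ltnP => ip; rewrite ?expr0 ?expr1 ?mul1r ?mulrNN ?mul1r.
Qed.

Lemma sum_lt1 m : (m <= n.+1)%N -> \sum_(i < n.+1 | (i < m)%N) 1 = m%:Z :> int.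
Proof.
move=> mn; rewrite -(big_ord_widen n.+1 (fun=> 1 : int) mn).
by rewrite sumr_const card_ord natz.
Qed.

Lemma sum_between1 : \sum_(i < n.+1 | (p <= i < nu)%N) 1 = nu%:Z - p%:Z :> int.
Proof.
have [/andP[pnu nun] _ _ _ _] := data.
rewrite -(sum_lt1 nun) -(sum_lt1 (leq_trans pnu nun)).
rewrite [X in _ = X - _](bigID (fun i : 'I_n.+1 => (i < p)%N)) /=.
have -> : \sum_(i < n.+1 | (i < nu)%N && (i < p)%N) 1 = \sum_(i < n.+1 | (i < p)%N) 1 :> int.
  apply: eq_bigl => i; rewrite andbC.
  by case: (ltnP i p) => //= ip; rewrite (leq_trans ip pnu).
by rewrite addrAC subrr add0r; apply: eq_bigl => i; rewrite -leqNgt andbC.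
Qed.

(** Positive exponents weigh 2, negative ones the [overline] of their absolute value; negating the
    relation exchanges the two kinds, which explains the shapes of the two bounds. *)
Lemma weight_signed_relation :
  (\sum_i weight (kappa 0%R i))%N%:Z =
  2 * p%:Z + \sum_(i < n.+1 | (p <= i < nu)%N) overline (lam i)%:Z.
Proof.
have [/andP[pnu nun] lam0 _ _ _] := data.
rewrite -natz natr_sum (big_signed_relation (F := fun _ a => (weight a)%:R)) //.
rewrite -(sum_lt1 (leq_trans pnu nun)) big_distrr /=; congr (_ + _).
  by apply: eq_bigr => i ip; rewrite weight_pos ?mulr1 // lam0 // (leq_trans ip pnu).
by apply: eq_bigr => i _; rewrite natz weight_oppn.
Qed.

Lemma weight_opp_signed_relation :
  (\sum_i weight ((- kappa) 0%R i))%N%:Z =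
  2 * (nu%:Z - p%:Z) + \sum_(i < n.+1 | (i < p)%N) overline (lam i)%:Z.
Proof.
have [/andP[pnu nun] lam0 _ _ _] := data.
under eq_bigr do rewrite [(- kappa) _ _]mxE.
rewrite -natz natr_sum (big_signed_relation (F := fun _ a => (weight (- a))%:R)); last first.
  by move=> i; rewrite oppr0.
rewrite addrC -sum_between1 big_distrr /=; congr (_ + _).
  by apply: eq_bigr => i /andP[_ inu]; rewrite opprK weight_pos ?mulr1 // lam0.
by apply: eq_bigr => i _; rewrite natz weight_oppn.
Qed.

(** So [delta] is the degree in [t] of the left-hand side of the equation when all [h_i] have degree
    [k], that is, minus its order at infinity. *)
Lemma assoc_deltaE :
  assoc_delta k l w p nu lam = assoc_N w p nu lam + k%:Z * l%:Z * \sum_i kappa 0 i.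
Proof.
have -> : \sum_i kappa 0 i = \sum_i kappa 0 i * 1 by apply: eq_bigr => i _; rewrite mulr1.
rewrite signed_relation_sum /assoc_delta PoszM mulrBr addrA.
by congr (_ + _ - _); congr (_ * _); apply: eq_bigr => i _; rewrite mulr1.
Qed.

Lemma card_signed_relation : (#|[pred i | kappa 0%R i != 0%R]| <= nu)%N.
Proof.
have [/andP[pnu nun] _ _ _ _] := data.
apply: (@leq_trans #|[pred i : 'I_n.+1 | (i < nu)%N]|).
  apply/subset_leq_card/fintype.subsetP => i; rewrite !inE mxE.
  case: ifP => [ip _|_]; first exact: leq_trans ip pnu.
  by case: ifP.
rewrite -sum1_card -(big_ord_widen n.+1 (fun=> 1%N) nun).
by rewrite sum_nat_const card_ord muln1.
Qed.
End SignedRelation.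

(** * From weights to the terms of the three inequalities *)

Lemma weight_nonneg (N : int) : 0 <= N -> (weight N)%:Z = chi (0 < N) + 1 - chi (N == 0).
Proof. by rewrite /weight /chi; case: ltgtP. Qed.

Lemma weight_opp_nonneg (N : int) : 0 <= N ->
  (weight (- N))%:Z = chi ((0 < N) && ~~ oddz N) + 1 - chi (N == 0).
Proof.
by rewrite /weight /chi oddzE oppr_eq0 oppr_lt0 abszN; case: ltgtP => //= _ _; case: odd.
Qed.

Lemma weight_oppE (d : int) :
  (weight (- d))%:Z = 2 - chi ((0 < d) && oddz d) - 2 * chi (d == 0).
Proof.
rewrite /weight /chi oddzE oppr_eq0 oppr_lt0 abszN.
by case: ltgtP => //= _; case: odd.
Qed.

Lemma weightE (d : int) :
  (weight d)%:Z = 2 - chi ((d < 0) && oddz d) - 2 * chi (d == 0).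
Proof.
by rewrite /weight /chi oddzE; case: ltgtP => //= _; case: odd.
Qed.

Unset Implicit Arguments.

Theorem theorem4p6 (R : realType) (n k l : nat)
  (w : 'I_n.+1 -> 'rV[int]_n.+1) (p nu : nat) (lam : 'I_n.+1 -> nat)
  (f : 'I_n.+1 -> laurent R n.+1) (r : nat)
  (C := near_circuit_points k l w)
  (N := assoc_N w p nu lam) (delta := assoc_delta k l w p nu lam) :
  is_near_circuit k l w R -> primitive k l w ->
  associated_data w p nu lam ->
  has_support f C -> generic_system f C ->
  real_solutions f #= `I_r ->
  [/\ r%:Z <= 2 * k%:Z * overline l%:Z * p%:Z
        + k%:Z * overline l%:Z
            * (\sum_(i < n.+1 | (p <= i < nu)%N) overline (lam i)%:Z)
        + chi (0 < N) + 1
        - chi ((0 < delta) && oddz delta) - chi (delta == 0)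
        - overline l%:Z * (chi (delta == 0) + chi (N == 0)),
      r%:Z <= 2 * k%:Z * overline l%:Z * (nu%:Z - p%:Z)
        + k%:Z * overline l%:Z
            * (\sum_(i < n.+1 | (i < p)%N) overline (lam i)%:Z)
        + chi ((0 < N) && ~~ oddz N) + 1
        - chi ((delta < 0) && oddz delta) - chi (delta == 0)
        - overline l%:Z * (chi (delta == 0) + chi (N == 0))
    & ~~ odd l -> oddz N -> r%:Z <= 2 * k%:Z * nu%:Z + 1].

Proof.
move=> [k0 l0 _ _] prim data supp gen real_r.
have [/andP[pnu nun] lam0 _ _ N0] := data.
rewrite -/N in N0.
have kW := signed_relationW data; have bez := signed_relation_bezout data.
set kappa := signed_relation p nu lam in kW bez.
have [ol|el] := boolP (odd l).
  have ovl : overline l%:Z = 1.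
    by rewrite /overline ltz_nat l0 oddzE /= ol.
  have h1 := count_odd k0 l0 prim kW bez supp gen real_r ol.
  (* The second inequality is the same count for the opposite relation, which replaces [N] and
     [delta] by their opposites. *)
  have kW' : (- kappa) *m (\matrix_i w i) = (- (- N)) *: e_last int n.
    by rewrite mulNmx kW [RHS]scaleNr.
  have bez' : exists rho : 'cV[int]_n.+1, ((- kappa) *m rho) 0 0 = 1.
    by have [rho kr] := bez; exists (- rho); rewrite mulNmx mulmxN opprK.
  have h2 := count_odd k0 l0 prim kW' bez' supp gen real_r ol.
  have D' : \sum_i (- kappa) 0 i = - \sum_i kappa 0 i.
    by rewrite -sumrN; apply: eq_bigr => i _; rewrite mxE.
  rewrite -(assoc_deltaE k l data) -/delta in h1.
  rewrite D' mulrN -opprD -(assoc_deltaE k l data) -/delta opprK in h2.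
  have e1 := weight_signed_relation data; have e2 := weight_opp_signed_relation data.
  have a1 := weight_nonneg N0; have a2 := weight_opp_nonneg N0.
  have b1 := weight_oppE delta; have b2 := weightE delta.
  have arith (x c S y0 y1 y2 y3 y4 : int) :
      x + 2 <= c * (2 * y0 + S) + (y1 + 1 - y2) + (2 - y3 - 2 * y4) ->
      x <= 2 * c * y0 + c * S + y1 + 1 - y3 - y4 - (y4 + y2).
    by clear; lia.
  rewrite ovl !mulr1 !mul1r; split; last by [].
    by apply: arith; rewrite -e1 -a1 -b1 -PoszM -!PoszD lez_nat.
  by apply: arith; rewrite -e2 -a2 -b2 -PoszM -!PoszD lez_nat.
(* For [l] even, [N] and hence [delta] are odd, so neither is 0, and the first two inequalities
   follow from the third bound. *)
have ovl : overline l%:Z = 2.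
  by rewrite /overline ltz_nat l0 oddzE /= (negPf el).
have oN : odd `|N|%N := even_l_odd_N prim kW bez el.
have r3 : r%:Z <= 2 * k%:Z * nu%:Z + 1.
  have := count_even l0 prim kW bez supp gen real_r el.
  have := card_signed_relation data.
  rewrite -/kappa; move: #|_| => c; clear -k0; nia.
have oddN : oddz N by rewrite oddzE.
have NP : 0 < N.
  by rewrite lt_neqAle N0 andbT; apply: contraTneq oN => <-.
have oddd : oddz delta.
  have odd_absD (a b : int) : ~~ odd `|b|%N -> odd `|(a + b)%R|%N = odd `|a|%N by clear; lia.
  by rewrite oddzE /delta (assoc_deltaE k l data) odd_absD // !abszM !oddM (negPf el) andbF.
have d0 : delta != 0 by apply: contraTneq oddd => ->.
have overline_ge1 (P : pred 'I_n.+1) : (forall i, P i -> (i < nu)%N) ->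
    \sum_(i < n.+1 | P i) 1 <= \sum_(i < n.+1 | P i) overline (lam i)%:Z.
  move=> Pnu; apply: ler_sum => i /Pnu /lam0 li.
  by rewrite /overline ltz_nat li; case: ifP.
have o1 : nu%:Z - p%:Z <= \sum_(i < n.+1 | (p <= i < nu)%N) overline (lam i)%:Z.
  by rewrite -(sum_between1 data); apply: overline_ge1 => i /andP[].
have o2 : p%:Z <= \sum_(i < n.+1 | (i < p)%N) overline (lam i)%:Z.
  rewrite -{1}(sum_lt1 (leq_trans pnu nun)); apply: overline_ge1 => i ip.
  exact: leq_trans ip pnu.
(* If [p = nu], the subtracted sum in [delta] is empty. Hence [delta < 0] gives [nu - p >= 1], which
   pays for the term subtracted in the second inequality. *)
have dneg : delta < 0 -> (p < nu)%N.
  move=> dlt; rewrite ltn_neqAle pnu andbT; apply: contraTneq dlt => pn.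
  rewrite -leNgt /delta /assoc_delta [X in _ - _ * X]big_pred0; last first.
    by move=> i; rewrite -pn; case: leqP.
  by rewrite mulr0 subr0 addr_ge0 // mulr_ge0 //; apply: sumr_ge0.
have arith1 (x c S y0 y1 y2 : int) : 0 < c -> 0 <= y0 -> y1 - y0 <= S -> y2 <= 1 ->
    x <= 2 * c * y1 + 1 -> x <= 2 * c * 2 * y0 + c * 2 * S + 1 + 1 - y2 - 0 - 2 * (0 + 0).
  by clear; nia.
have arith2 (x c S y0 y1 y2 : int) : 0 < c -> y0 <= S -> y2 <= y1 - y0 -> 0 <= y1 - y0 ->
    x <= 2 * c * y1 + 1 -> x <= 2 * c * 2 * (y1 - y0) + c * 2 * S + 0 + 1 - y2 - 0 - 2 * (0 + 0).
  by clear; nia.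
rewrite ovl oddN oddd NP (negPf d0) (gt_eqF NP) /= /chi; split; last by [].
  apply: (arith1 _ _ _ _ _ _ _ _ o1 _ r3) => //; by case: ifP.
apply: (arith2 _ _ _ _ _ _ _ o2 _ _ r3) => //; last by rewrite subr_ge0 lez_nat.
case: ifP => [/andP[/dneg pn _]|_]; last by rewrite subr_ge0 lez_nat.
by move: pn; clear; lia.
Qed.
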